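(* Let $G$ be a planar graph in which no $4$-cycle is adjacent to a $3$-cycle. Then $G$ is DP-vertex-$2$-arborable; that is, for every assignment $L$ of lists with $|L(v)|=2$ for every $v\in V(G)$, and every cover $H$ of $G$ with respect to $L$, there is a representative set $S$ of $G$ in $H$ such that the representative graph $G_S$ is a forest.
   Context: All graphs are finite, simple and undirected. Two cycles are adjacent if they share at least one edge. A $k$-assignment $L$ of $G$ assigns to each vertex $v$ a list (set of colors) $L(v)$ with $|L(v)|=k$. Given a list assignment $L$ of $G$, a graph $H$ is a cover of $G$ (with respect to $L$) if: (i) $V(H)=\bigcup_{u\in V(G)}(\{u\}\times L(u))$; (ii) for each $u\in V(G)$, the induced subgraph $H[\{u\}\times L(u)]$ is complete; (iii) for each edge $uv\in E(G)$, the set of edges of $H$ with one endpoint in $\{u\}\times L(u)$ and the other in $\{v\}\times L(v)$ is a matching (possibly empty); (iv) if $u\neq v$ and $uv\notin E(G)$, then no edge of $H$ joins $\{u\}\times L(u)$ and $\{v\}\times L(v)$. A representative set $S$ of $G$ is a set of vertices of $H$ such that $|S|=|V(G)|$ and $u\neq v$ for any two different members $(u,c)$ and $(v,c')$ of $S$ (so $S$ contains exactly one vertex $(v,c)$ for each $v\in V(G)$). The representative graph $G_S$ has vertex set $V(G)$, and $u,v$ are adjacent in $G_S$ if and only if there are $(u,i),(v,j)\in S$ (with $u\ne v$) that are adjacent in $H$. A DP-forested-coloring of $(G,H)$ is a representative set $S$ such that $G_S$ is a forest. $G$ is DP-vertex-$k$-arborable if $(G,H)$ has a DP-forested-coloring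 for each $k$-assignment $L$ and each cover $H$ of $G$ with respect to $L$. *)

(* Defs.v *)
From mathcomp Require Import all_boot all_order all_algebra.
From mathcomp Require Import finmap reals.

Set Implicit Arguments.
Unset Strict Implicit.
Unset Printing Implicit Defensive.

Import Order.TTheory GRing.Theory Num.Theory.
Local Open Scope fset_scope.

(** ** Simple graphs, cycles, forests *)

Definition simple_graph (T : Type) (e : rel T) : Prop :=
  symmetric e /\ irreflexive e.

Definition graph_cycle (T : eqType) (e : rel T) (c : seq T) : bool :=
  (2 < size c) && ucycleb e c.

Definition cycle_edges (V : finType) (c : seq V) : {set {set V}} :=
  [set [set x; next c x] | x in c].

Definition adjacent_cycles (V : finType) (c c' : seq V) : Prop :=
  cycle_edges c :&: cycle_edges c' != set0.

Definition forest (V : eqType) (e : rel V) : Prop :=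
  forall c : seq V, ~~ graph_cycle e c.

(** ** Planarity *)

(** As in Diestel's _Graph Theory_, an edge of a plane graph is drawn as an
    arc consisting of finitely many straight segments.  Such an arc is given
    by the list of its successive corner points, end points included. *)
Section Plane.
Local Open Scope ring_scope.
Variable R : realType.

Definition on_segment (a b p : R * R) : Prop :=
  exists2 t : R, 0 <= t <= 1 &
    p = (a.1 + t * (b.1 - a.1), a.2 + t * (b.2 - a.2)).

Definition on_side (s : seq (R * R)) (i : nat) (p : R * R) : Prop :=
  (i.+1 < size s)%N /\ on_segment (nth 0 s i) (nth 0 s i.+1) p.

Definition on_polyline (s : seq (R * R)) (p : R * R) : Prop :=
  exists i : nat, on_side s i p.

(** The sides are nondegenerate and two sides meet only if they are
    consecutive, and then only in their common corner; hence the polyline is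
    homeomorphic to the unit interval. *)
Definition simple_polyline (s : seq (R * R)) : Prop :=
  [/\ (1 < size s)%N,
      forall i : nat, (i.+1 < size s)%N -> nth 0 s i != nth 0 s i.+1
    & forall (i j : nat) (p : R * R), (i < j)%N ->
        on_side s i p -> on_side s j p -> j = i.+1 /\ p = nth 0 s j].

(** [arc u v] is only meaningful when [e u v]; [arc v u] is then the same arc
    traversed backwards. *)
Record plane_drawing (V : finType) (e : rel V)
    (pos : V -> R * R) (arc : V -> V -> seq (R * R)) : Prop := PlaneDrawing {
  drawing_inj : injective pos;
  drawing_arc : forall u v : V, e u v ->
    [/\ simple_polyline (arc u v), head 0 (arc u v) = pos u,
        last 0 (arc u v) = pos v & arc v u = rev (arc u v)];
  drawing_vertex : forall (u v w : V) (p : R * R), e u v ->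
    on_polyline (arc u v) p -> p != pos u -> p != pos v -> p != pos w;
  drawing_cross : forall (u v x y : V) (p : R * R), e u v -> e x y ->
    [set u; v] != [set x; y] ->
    on_polyline (arc u v) p -> p != pos u -> p != pos v ->
    ~ on_polyline (arc x y) p
}.

Definition planar (V : finType) (e : rel V) : Prop :=
  exists (pos : V -> R * R) (arc : V -> V -> seq (R * R)),
    plane_drawing e pos arc.

End Plane.

(** ** DP-forested-colorings *)

Section DP.
Variables (V : finType) (e : rel V) (C : choiceType).

Definition k_assignment (k : nat) (L : V -> {fset C}) : Prop :=
  forall v : V, #|` L v| = k.

Definition cover_vertex (L : V -> {fset C}) : pred (V * C) :=
  [pred p | p.2 \in L p.1].

(** A cover is a simple graph whose vertex set is [cover_vertex L]; it is given
    by an adjacency relation on [V * C] relating no other pairs. *)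
Record cover (L : V -> {fset C}) (H : rel (V * C)) : Prop := Cover {
  cover_simple : simple_graph H;
  cover_verts : forall p q : V * C, H p q ->
    p \in cover_vertex L /\ q \in cover_vertex L;
  cover_clique : forall (u : V) (c d : C),
    c \in L u -> d \in L u -> c != d -> H (u, c) (u, d);
  cover_matching : forall (u v : V) (c d c' d' : C), e u v ->
    H (u, c) (v, d) -> H (u, c') (v, d') -> (c = c' <-> d = d');
  cover_nonadj : forall (u v : V) (c d : C),
    u != v -> ~~ e u v -> ~~ H (u, c) (v, d)
}.

Definition representative_set (L : V -> {fset C}) (S : {fset V * C}) : Prop :=
  [/\ {subset S <= cover_vertex L}, #|` S| = #|V|
    & {in S &, injective (@fst V C)}].

Definition representative_graph (H : rel (V * C)) (S : {fset V * C}) : rel V :=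
  fun u v => (u != v) && [exists p : S, [exists q : S,
    [&& (val p).1 == u, (val q).1 == v & H (val p) (val q)]]].

Definition DP_forested_coloring (L : V -> {fset C}) (H : rel (V * C))
    (S : {fset V * C}) : Prop :=
  representative_set L S /\ forest (representative_graph H S).

End DP.

Definition DP_vertex_arborable (k : nat) (V : finType) (e : rel V) : Prop :=
  forall (C : choiceType) (L : V -> {fset C}) (H : rel (V * C)),
    k_assignment k L -> cover e L H ->
    exists S : {fset V * C}, DP_forested_coloring L H S.

(* Main.v *)
Require Import Defs.
From mathcomp Require Import all_boot all_order all_algebra.
From mathcomp Require Import finmap reals.
From mathcomp Require Import zify ring lra.

Set Implicit Arguments.
Unset Strict Implicit.
Unset Printing Implicit Defensive.

Import Order.TTheory GRing.Theory Num.Theory.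

(** The coloring is built by induction on the set [W] of colored vertices.  It
    rests on an unavoidability statement ([unavoidable]): a nonempty [W]
    contains a vertex with at most three neighbors in [W], or a _house_, that
    is, a 5-cycle together with the apex of a triangle on one of its edges,
    whose six vertices all have degree at most four in [W].

    Both configurations are reducible.  By the matching condition, a colored
    neighbor clashes with at most one of the two colors of a vertex [v]; if at
    most three neighbors of [v] are colored, then some color of [v] clashes at
    most once, and a forest stays a forest when a vertex of degree at most one
    is added ([forest_on_add], [greedy_color]).  In a house one colors greedily
    along an order in which every vertex but the last has a later neighbor, so
    that only the last one can be stuck; the vertices colored first are chosen
    so as to save it ([house_extends]).

    Unavoidability is a discharging argument ([euler_defect]).  If all degrees
    are at least four, give charge 6(k-4) to a vertex of degree k and 6(n-4) to
    a face of size n; by Euler's formula the total is negative.  A triangle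
    borders neither a triangle nor a 4-face, so it can draw 2 units from each
    of its three neighboring faces.  Faces of size at least six can afford
    this, and so can 5-faces with at most three adjacent triangles.  A 5-face
    with four or five adjacent triangles is paid by its vertices of degree at
    least five; if it has none and there is no house, then the apices of its
    adjacent triangles have degree at least five, and they pay.  A vertex of
    degree at least five never gives more than it has.  Hence the total is
    nonnegative, a contradiction.

    Faces are the orbits of a permutation of the darts, given by the clockwise
    order of the arcs around each vertex, and only V - E + F >= 1 is needed.
    This inequality bounds the number of faces from below, and it holds
    without any appeal to the Jordan curve theorem ([strip_classes]).  Shear
    the plane so that all corners of the arcs have distinct abscissas.  Let
    there be one region just above each straight side, and one region below
    everything; each corner glues the region reached from its left to the
    region reached from its right.  With E' sides and V' corners, at least
    E' + 1 - V' classes of regions survive the gluing.  Walking along a face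
    never changes the class of the region on its left, and every class lies to
    the left of some side, so F >= E' + 1 - V' = E + 1 - V. *)

(** * Reducible configurations *)

Definition nbrs (V : finType) (e : rel V) (W : {set V}) (v : V) : {set V} :=
  [set w in W | e v w].

(** The house with roof [u] over the edge [a b] of the 5-cycle [a b c d x].  It
    is induced: the two cycles share the edge [a b] and span no other edge. *)
Record house (V : finType) (e : rel V) (W : {set V}) (u a b c d x : V) : Prop :=
  House {
    house_uniq : uniq [:: u; a; b; c; d; x];
    house_sub : {subset [:: u; a; b; c; d; x] <= W};
    house_roof : e u a && e u b;
    house_cycle : [&& e a b, e b c, e c d, e d x & e x a];
    house_apex_induced : [&& ~~ e u c, ~~ e u d & ~~ e u x];
    house_chordless : [&& ~~ e a c, ~~ e a d, ~~ e b d, ~~ e b x & ~~ e c x];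
    house_degree : {in [:: u; a; b; c; d; x], forall v, #|nbrs e W v| <= 4}
  }.

Section Coloring.
Variables (V : finType) (e : rel V) (C : choiceType).
Variables (L : V -> {fset C}) (H : rel (V * C)).
Hypotheses (he : simple_graph e) (hL : k_assignment 2 L) (hH : Defs.cover e L H).

Definition clash (f : V -> C) : rel V :=
  fun u v => (u != v) && H (u, f u) (v, f v).

Definition forest_on (W : {set V}) (f : V -> C) : Prop :=
  forest [rel u v | [&& u \in W, v \in W & clash f u v]].

Definition recolor (f : V -> C) (v : V) (c : C) : V -> C :=
  fun w => if w == v then c else f w.

Definition conflicts (f : V -> C) (W : {set V}) (v : V) (c : C) : {set V} :=
  [set w in W | (w != v) && H (v, c) (w, f w)].

Definition good (W : {set V}) (f : V -> C) : Prop :=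
  (forall v, f v \in L v) /\ forest_on W f.

Let e_sym : symmetric e. Proof. by case: he. Qed.
Let e_irr : irreflexive e. Proof. by case: he. Qed.
Let H_sym : symmetric H. Proof. by case: (cover_simple hH). Qed.

Lemma clash_sym f : symmetric (clash f).
Proof. by move=> u v; rewrite /clash eq_sym H_sym. Qed.

Lemma recolor_same f v c : recolor f v c v = c.
Proof. by rewrite /recolor eqxx. Qed.

Lemma recolor_other f v c w : w != v -> recolor f v c w = f w.
Proof. by rewrite /recolor => /negPf ->. Qed.

Lemma conflicts_sub_nbrs f W v c : conflicts f W v c \subset nbrs e W v.
Proof.
apply/subsetP => w; rewrite !inE => /and3P[-> wv hw] /=.
apply/negPn/negP => nadj.
by have := cover_nonadj hH c (f w) _ nadj; rewrite eq_sym wv hw => /(_ isT).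
Qed.

(** A cycle through the new vertex would leave it along two distinct edges. *)
Lemma forest_on_add (W : {set V}) f v c :
  v \notin W -> forest_on W f -> #|conflicts f W v c| <= 1 ->
  forest_on (v |: W) (recolor f v c).
Proof.
move=> vW fW cf s; apply/negP => /andP[s2 /andP[cs us]].
have [vs|vs] := boolP (v \in s); last first.
  have /negP := fW s; apply; rewrite /graph_cycle s2 /ucycleb us andbT /=.
  apply: (@sub_in_cycle _ (mem s) [rel u v0 | [&& u \in v |: W,
     v0 \in v |: W & clash (recolor f v c) u v0]]) cs; last exact/allP.
  move=> a b as_ bs /=.
  have nav : a != v by apply: contraNneq vs => <-.
  have nbv : b != v by apply: contraNneq vs => <-.
  by rewrite !inE (negPf nav) (negPf nbv) /= /clash !recolor_other.
have [i s' def_s] := rot_to vs.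
move: cs; rewrite -(rot_cycle i) def_s => cs.
have us' : uniq (v :: s') by rewrite -def_s rot_uniq.
have ss' : size s = (size s').+1 by rewrite -(size_rot i) def_s.
case: s' {def_s} cs us' ss' => [|x s'] cs us' ss'; first by rewrite ss' in s2.
case/lastP: s' cs us' ss' => [|s' y] cs us' ss'; first by rewrite ss' in s2.
move: cs; rewrite /= rcons_path last_rcons /= => /and3P[] /and3P[_ xW vx] _.
move=> /and3P[yW _ yv].
move: us'; rewrite /= inE negb_or !mem_rcons !inE !negb_or.
case/and3P => /and3P[vx' vy' _] /andP[xy _] _.
have inc z : z != v -> z \in v |: W -> clash (recolor f v c) v z ->
    z \in conflicts f W v c.
  move=> zv; rewrite !inE (negPf zv) /= => -> /andP[_].
  by rewrite recolor_same recolor_other.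
have x_in : x \in conflicts f W v c by apply: inc => //; rewrite eq_sym.
have y_in : y \in conflicts f W v c.
  by apply: inc => //; [rewrite eq_sym|rewrite clash_sym].
move/card_le1_eqP: cf => /(_ _ _ x_in y_in) exy.
by rewrite exy eqxx in xy.
Qed.

Lemma good_add (W : {set V}) f v c :
  v \notin W -> good W f -> c \in L v -> #|conflicts f W v c| <= 1 ->
  good (v |: W) (recolor f v c).
Proof.
move=> vW [fL fW] cL cf; split; last exact: forest_on_add.
by move=> w; rewrite /recolor; case: eqP => [->|].
Qed.

Lemma two_colors v : exists c d, [/\ c \in L v, d \in L v & c != d].
Proof.
have := fset_uniq (L v); have := hL v.
case E: (enum_fset (L v)) => [|c [|d [|]]] //= _; rewrite inE andbT => cd.
have inL z : (z \in L v) = (z \in enum_fset (L v)) by [].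
by exists c, d; rewrite !inL E !inE !eqxx orbT.
Qed.

Lemma match_unique v w c d k : c \in L v -> d \in L v -> c != d -> v != w ->
  H (v, c) (w, k) -> ~~ H (v, d) (w, k).
Proof.
move=> cL dL cd vw hc; apply/negP => hd.
have [evw|nevw] := boolP (e v w).
  by have [_ /(_ erefl) E] := cover_matching hH evw hc hd; rewrite E eqxx in cd.
by have /negP := cover_nonadj hH c k vw nevw.
Qed.

Lemma avoiding_color v w k : v != w -> exists2 c, c \in L v & ~~ H (v, c) (w, k).
Proof.
move=> vw; have [c [d [cL dL cd]]] := two_colors v.
have [hc|hc] := boolP (H (v, c) (w, k)); last by exists c.
by exists d => //; apply: match_unique hc.
Qed.

(** The matching condition: a colored neighbor clashes with at most one of two
    colors of [v]. *)
Lemma conflicts_two f W v c d : c \in L v -> d \in L v -> c != d ->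
  #|conflicts f W v c| + #|conflicts f W v d| <= #|nbrs e W v|.
Proof.
move=> cL dL cd; rewrite -cardsUI.
have -> : conflicts f W v c :&: conflicts f W v d = set0.
  apply/setP => w; rewrite !inE; apply/negP => /andP[/and3P[_ wv hc] /and3P[_ _ hd]].
  rewrite eq_sym in wv.
  by have /negP := match_unique cL dL cd wv hc.
by rewrite cards0 addn0 subset_leq_card // subUset !conflicts_sub_nbrs.
Qed.

Lemma greedy_color f (W : {set V}) v : #|nbrs e W v| <= 3 ->
  exists2 c, c \in L v & #|conflicts f W v c| <= 1.
Proof.
move=> n3; have [c [d [cL dL cd]]] := two_colors v.
have := conflicts_two f W cL dL cd.
have [c1|c1] := leqP #|conflicts f W v c| 1; first by exists c.
by exists d => //; lia.
Qed.

(** Each vertex has at most three neighbors among those colored when its turn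
    comes. *)
Fixpoint greedy_order (W : {set V}) (s : seq V) : bool :=
  if s is v :: s' then
    [&& v \notin W, #|nbrs e W v| <= 3 & greedy_order (v |: W) s']
  else true.

Lemma greedy_extension (W : {set V}) f s : good W f -> greedy_order W s ->
  exists2 g, good (W :|: [set x in s]) g & {in [predC s], g =1 f}.
Proof.
elim: s W f => [|v s IHs] W f gf /=.
  move=> _; exists f => //; congr (good _ f): gf.
  by apply/setP => x; rewrite !inE orbF.
case/and3P => vW n3 go; have [c cL c1] := greedy_color f n3.
have [g gg geq] := IHs _ _ (good_add vW gf cL c1) go.
exists g; first congr (good _ g): gg.
  by apply/setP => x; rewrite !inE orbCA orbA.
move=> w; rewrite inE [w \in v :: s]inE negb_or => /andP[wv ws].
by rewrite geq ?inE // recolor_other.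
Qed.

(** How the last vertex [y] is saved when it has a color [c] that is still
    free: the first vertex [x] avoids [(y, c)], hence only the other neighbor
    of [y] in [s] can clash with [c]. *)
Lemma finish_free (W : {set V}) f x y s c :
  good W f -> x \notin W -> y \notin W -> x != y -> #|nbrs e W x| <= 1 ->
  c \in L y -> conflicts f W y c = set0 ->
  greedy_order (x |: W) s -> all [predC W] s -> x \notin s -> y \notin s ->
  #|nbrs e [set z in s] y| <= 1 ->
  exists g, good (y |: (x |: W :|: [set z in s])) g.
Proof.
move=> gf xW yW xy nx cL c0 go sW xs ys ny.
have [k kL kc] := avoiding_color c xy.
have k1 : #|conflicts f W x k| <= 1.
  exact: leq_trans (subset_leq_card (conflicts_sub_nbrs _ _ _ _)) nx.
have [g gg geq] := greedy_extension (good_add xW gf kL k1) go.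
exists (recolor g y c); apply: good_add => //.
  by rewrite !inE (negPf ys) (negPf yW) orbF eq_sym (negPf xy).
apply: leq_trans ny; apply/subset_leq_card/subsetP => w.
rewrite !inE => /and3P[wW wy hw].
have eyw : e y w.
  by apply/negPn/negP => ne; have := cover_nonadj hH c (g w) _ ne;
     rewrite eq_sym wy hw => /(_ isT).
rewrite eyw andbT; apply/negPn/negP => ws.
rewrite (negPf ws) orbF in wW; move: hw; rewrite geq ?inE //.
case/orP: wW => [/eqP->|wW]; first by rewrite recolor_same H_sym (negPf kc).
have wx : w != x by apply: contraNneq xW => <-.
rewrite recolor_other // => hw.
by have := in_set0 w; rewrite -c0 !inE wW wy hw.
Qed.

Lemma nbrs_card (W W' : {set V}) v s : uniq s -> W' \subset W ->
  all [pred z | [&& z \in W, z \notin W' & e v z]] s ->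
  #|nbrs e W' v| + size s <= #|nbrs e W v|.
Proof.
move=> us /subsetP WW' /allP hs.
have -> : size s = #|[set x in s]| by rewrite cardsE (card_uniqP us).
rewrite -cardsUI.
have -> : nbrs e W' v :&: [set x in s] = set0.
  apply/setP => z; rewrite !inE; apply/negP => /andP[/andP[zW _] /hs /=].
  by rewrite zW /= andbF.
rewrite cards0 addn0; apply/subset_leq_card/subsetP => z; rewrite !inE.
by case/orP => [/andP[/WW' -> ->]//|/hs /= /and3P[-> _ ->]].
Qed.

Section HouseReduction.
Variables (W W0 : {set V}) (u a b c d x : V).
Hypothesis hK : house e W u a b c d x.
Let K := [:: u; a; b; c; d; x].
Hypothesis defW0 : W0 = W :\: [set z in K].

Let house_bound (W' : {set V}) v s : v \in K -> uniq s -> W' \subset W ->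
  all [pred z | [&& z \in W, z \notin W' & e v z]] s ->
  #|nbrs e W' v| + size s <= 4.
Proof.
move=> vK us sub h; apply: leq_trans (house_degree hK vK).
exact: nbrs_card.
Qed.

Let W0K z : z \in K -> z \notin W0.
Proof. by move=> zK; rewrite defW0 in_setD in_set zK. Qed.

Let KW z : z \in K -> z \in W.
Proof. exact: house_sub hK z. Qed.

Lemma house_full (W' : {set V}) (s : seq V) : s =i K ->
  W' = W0 :|: [set z in s] -> W' = W.
Proof.
move=> sK ->; apply/setP => z; rewrite defW0 in_setU in_setD !in_set sK.
by case zK: (z \in K); rewrite ?orbF // (KW zK).
Qed.

(** If [u] has a color without conflict outside the house, the order
    [b, c, d, x, a, u] works, where [b] spares that color of [u]; if [x] has
    one, so does [a, u, b, c, d, x].  Otherwise every color of [u] and of [x]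
    has exactly one conflict outside, so [u] and [x] may be colored first and
    with any color; they both spare a color of [a] that has no conflict
    outside, and [a], colored last, can then clash with [b] only. *)
Lemma house_extends f : good W0 f -> exists g, good W g.
Proof.
move=> gf.
have W0W : W0 \subset W by rewrite defW0 subsetDl.
have [uW aW bW [cW dW xW]] : [/\ u \in W, a \in W, b \in W &
    [/\ c \in W, d \in W & x \in W]].
  by split; [| | |split]; apply: KW; rewrite !inE eqxx ?orbT.
have [u0 a0 b0 [c0 d0 x0]] : [/\ u \notin W0, a \notin W0, b \notin W0 &
    [/\ c \notin W0, d \notin W0 & x \notin W0]].
  by split; [| | |split]; apply: W0K; rewrite !inE eqxx ?orbT.
have sub (W1 : {set V}) z : W1 \subset W -> z \in W -> z |: W1 \subset W.
  by move=> s1 zW; rewrite subUset sub1set zW s1.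
have [uK aK bK [cK dK xK]] : [/\ u \in K, a \in K, b \in K &
    [/\ c \in K, d \in K & x \in K]].
  by split; [| | |split]; rewrite !inE eqxx ?orbT.
have /= := house_uniq hK; rewrite !inE !negb_or andbT.
move=> /and5P[/and5P[ua ub uc ud ux] /and4P[ab ac ad ax]].
move=> /and3P[bc bd bx] /andP[cd cx] dx.
have [[eua eub] [eab ebc ecd edx exa]] :
    (e u a /\ e u b) /\ [/\ e a b, e b c, e c d, e d x & e x a].
  by have /andP[? ?] := house_roof hK; have /and5P[? ? ? ? ?] := house_cycle hK.
have /and3P[nuc nud nux] := house_apex_induced hK.
have /and5P[nac nad nbd nbx ncx] := house_chordless hK.
have eqC (v w : V) : v != w -> w != v by rewrite eq_sym.
have NE := (negPf ua, negPf ub, negPf uc, negPf ud, negPf ux, negPf ab, negPf ac,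
  negPf ad, negPf ax, (negPf bc, negPf bd, negPf bx, negPf cd, negPf cx, negPf dx),
  (negPf (eqC _ _ ua), negPf (eqC _ _ ub), negPf (eqC _ _ uc), negPf (eqC _ _ ud),
   negPf (eqC _ _ ux), negPf (eqC _ _ ab), negPf (eqC _ _ ac),
   negPf (eqC _ _ ad), negPf (eqC _ _ ax)), (negPf (eqC _ _ bc),
   negPf (eqC _ _ bd), negPf (eqC _ _ bx), negPf (eqC _ _ cd),
   negPf (eqC _ _ cx), negPf (eqC _ _ dx))).
have N0 := (negPf u0, negPf a0, negPf b0, negPf c0, negPf d0, negPf x0).
have later (W1 : {set V}) v z : v \in K -> W1 \subset W -> z \in W ->
    z \notin W1 -> e v z -> #|nbrs e W1 v| <= 3.
  move=> vK s1 zW z1 evz.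
  by have := @house_bound W1 v [:: z] vK isT s1; rewrite /= zW z1 evz addn1 => /(_ isT).
have later2 (W1 : {set V}) v y z : v \in K -> W1 \subset W -> y \in W -> z \in W ->
    y != z -> y \notin W1 -> z \notin W1 -> e v y -> e v z -> #|nbrs e W1 v| <= 2.
  move=> vK s1 yW zW yz y1 z1 evy evz.
  have := @house_bound W1 v [:: y; z] vK; rewrite /= inE yz => /(_ isT s1).
  by rewrite yW zW y1 z1 evy evz addn2 => /(_ isT).
have later3 (W1 : {set V}) v y z t : v \in K -> W1 \subset W -> uniq [:: y; z; t] ->
    {subset [:: y; z; t] <= W} ->
    y \notin W1 -> z \notin W1 -> t \notin W1 -> e v y -> e v z -> e v t ->
    #|nbrs e W1 v| <= 1.
  move=> vK s1 us sW y1 z1 t1 evy evz evt.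
  have [yW zW tW] : [/\ y \in W, z \in W & t \in W].
    by split; apply: sW; rewrite !inE eqxx ?orbT.
  have := @house_bound W1 v [:: y; z; t] vK us s1.
  by rewrite /= y1 z1 t1 evy evz evt yW zW tW addn3 => /(_ isT).
have nb1 (s : seq V) v z : {in s, forall w, e v w -> w = z} ->
    #|nbrs e [set w in s] v| <= 1.
  move=> h; rewrite -(cards1 z); apply/subset_leq_card/subsetP => w.
  by rewrite !inE => /andP[ws vw]; rewrite (h w).
have [/existsP[k /eqP k0]|nu] :=
    boolP [exists k : L u, conflicts f W0 u (val k) == set0].
  have [] := @finish_free W0 f b u [:: c; d; x; a] (val k) gf b0 u0 _ _ (fsvalP k) k0.
  - by rewrite NE.
  - apply: (later3 W0 b u a c) => //; rewrite 1?e_sym //; first by rewrite /= !inE !NE.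
    by move=> z; rewrite !inE => /or3P[] /eqP->.
  - rewrite /= !inE !N0 !NE /= ?andbT; apply/and4P; split.
    + by apply: (later _ c d); rewrite ?sub // !inE !N0 !NE.
    + by apply: (later _ d x); rewrite ?sub // !inE !N0 !NE.
    + by apply: (later _ x a); rewrite ?sub // !inE !N0 !NE.
    + by apply: (later _ a u); rewrite ?sub // 1?e_sym // !inE !N0 !NE.
  - by rewrite /= !N0.
  - by rewrite !inE !NE.
  - by rewrite !inE !NE.
  - apply: (nb1 _ _ a) => w; rewrite !inE => /or4P[] /eqP-> //.
    + by rewrite (negPf nuc). + by rewrite (negPf nud). + by rewrite (negPf nux).
  move=> g gg; exists g; congr (good _ g): gg.
  apply: (@house_full _ [:: u; b; c; d; x; a]).
    by move=> p; rewrite !inE; do 6! case: (p == _).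
  by apply/setP => z; rewrite !inE; do 6! case: (z == _); rewrite ?orbT ?orbF.
have [/existsP[k /eqP k0]|nx] :=
    boolP [exists k : L x, conflicts f W0 x (val k) == set0].
  have [] := @finish_free W0 f a x [:: u; b; c; d] (val k) gf a0 x0 _ _ (fsvalP k) k0.
  - by rewrite NE.
  - apply: (later3 W0 a u b x) => //; rewrite 1?e_sym //; first by rewrite /= !inE !NE.
    by move=> z; rewrite !inE => /or3P[] /eqP->.
  - rewrite /= !inE !N0 !NE /= ?andbT; apply/and4P; split.
    + by apply: (later _ u b); rewrite ?sub // !inE !N0 !NE.
    + by apply: (later _ b c); rewrite ?sub // !inE !N0 !NE.
    + by apply: (later _ c d); rewrite ?sub // !inE !N0 !NE.
    + by apply: (later _ d x); rewrite ?sub // !inE !N0 !NE.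
  - by rewrite /= !N0.
  - by rewrite !inE !NE.
  - by rewrite !inE !NE.
  - apply: (nb1 _ _ d) => w; rewrite !inE => /or4P[] /eqP-> //; rewrite e_sym.
    + by rewrite (negPf nux). + by rewrite (negPf nbx). + by rewrite (negPf ncx).
  move=> g gg; exists g; congr (good _ g): gg.
  apply: (@house_full _ [:: x; a; u; b; c; d]).
    by move=> p; rewrite !inE; do 6! case: (p == _).
  by apply/setP => z; rewrite !inE; do 6! case: (z == _); rewrite ?orbT ?orbF.
have one_conflict v k : v \in K -> #|nbrs e W0 v| <= 2 ->
    ~~ [exists k : L v, conflicts f W0 v (val k) == set0] -> k \in L v ->
    #|conflicts f W0 v k| <= 1.
  move=> vK n2 nv kL.
  have pos j : j \in L v -> 0 < #|conflicts f W0 v j|.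
    move=> jL; rewrite card_gt0; apply: contra nv => j0.
    by apply/existsP; exists [` jL]%fset.
  have [j [j' [jL j'L jj]]] := two_colors v.
  have [kj|kj] := eqVneq k j.
    have := conflicts_two f W0 jL j'L jj; rewrite kj; move: (pos _ j'L) n2; clear; lia.
  have := conflicts_two f W0 kL jL kj; move: (pos _ jL) n2; clear; lia.
have [k kL k0] : exists2 k, k \in L a & conflicts f W0 a k = set0.
  have [j [j' [jL j'L jj]]] := two_colors a.
  have n1 : #|nbrs e W0 a| <= 1.
    apply: (later3 W0 a u b x) => //; rewrite 1?e_sym //; first by rewrite /= !inE !NE.
    by move=> z; rewrite !inE => /or3P[] /eqP->.
  have := conflicts_two f W0 jL j'L jj.
  have [j0|j0] := eqVneq (conflicts f W0 a j) set0; first by exists j.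
  move=> le; exists j' => //; apply/eqP; rewrite -cards_eq0.
  by move: j0 n1 le; rewrite -card_gt0; clear; lia.
have [ku kuL kuk] := avoiding_color k ua.
have [kx kxL kxk] := avoiding_color k (eqC _ _ ax).
have g1 : good (u |: W0) (recolor f u ku).
  apply: good_add => //; apply: one_conflict => //.
  by apply: (later2 W0 u a b); rewrite ?eua ?eub.
have g2 : good (x |: (u |: W0)) (recolor (recolor f u ku) x kx).
  apply: good_add => //; first by rewrite !inE NE N0.
  have n1 : #|conflicts f W0 x kx| <= 1.
    by apply: one_conflict => //; apply: (later2 W0 x a d); rewrite ?NE // e_sym.
  apply: leq_trans n1; apply/subset_leq_card/subsetP => w.
  rewrite !inE => /and3P[wW wx hw]; rewrite wx /=.
  have [wu|wu] := eqVneq w u.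
    move: hw; rewrite wu recolor_same => hw; have := cover_nonadj hH kx ku (eqC _ _ ux).
    by rewrite e_sym nux hw => /(_ isT).
  by move: wW hw; rewrite (negPf wu) recolor_other //= => -> ->.
have [] := @greedy_extension _ _ [:: d; c; b] g2.
  rewrite /= !inE !N0 !NE /= ?andbT; apply/and3P; split.
  + by apply: (later _ d c); rewrite ?sub // 1?e_sym // !inE !N0 !NE.
  + by apply: (later _ c b); rewrite ?sub // 1?e_sym // !inE !N0 !NE.
  + by apply: (later _ b a); rewrite ?sub // 1?e_sym // !inE !N0 !NE.
move=> g gg geq.
have gga : good (a |: (x |: (u |: W0) :|: [set z in [:: d; c; b]])) (recolor g a k).
  apply: good_add => //; first by rewrite !inE !NE !N0.
  rewrite -(cards1 b); apply/subset_leq_card/subsetP => w wC.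
  have := subsetP (conflicts_sub_nbrs _ _ _ _) w wC.
  rewrite in_set => /andP[_ eaw]; move: wC; rewrite !inE.
  have [->//|wb] := eqVneq w b.
  have wc : w != c by apply: contraNneq nac => <-.
  have wd : w != d by apply: contraNneq nad => <-.
  rewrite (negPf wc) (negPf wd) !orbF => /and3P[wW wa].
  rewrite geq; last by rewrite !inE (negPf wb) (negPf wc) (negPf wd).
  have [->|wx] := eqVneq w x; first by rewrite recolor_same H_sym (negPf kxk).
  rewrite recolor_other //.
  have [->|wu] := eqVneq w u; first by rewrite recolor_same H_sym (negPf kuk).
  rewrite recolor_other // => hw; have := in_set0 w; rewrite -k0 !inE wa hw /= andbT.
  by move: wW; rewrite (negPf wu) (negPf wx) /= => ->.
exists (recolor g a k); congr (good _ _): gga.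
apply: (@house_full _ [:: a; x; u; d; c; b]).
  by move=> p; rewrite !inE; do 6! case: (p == _).
by apply/setP => z; rewrite !inE; do 6! case: (z == _); rewrite ?orbT ?orbF.
Qed.

End HouseReduction.

Lemma good_coloring_exists :
  (forall W : {set V}, W != set0 ->
     (exists2 v, v \in W & #|nbrs e W v| <= 3) \/
     (exists u a b c d x, house e W u a b c d x)) ->
  exists f, good [set: V] f.
Proof.
move=> unavoidable.
suff /(_ #|V| [set: V]) : forall n (W : {set V}), #|W| <= n -> exists f, good W f.
  by apply; rewrite cardsT.
elim=> [|n IHn] W leWn.
  have [f fL] : exists f : V -> C, forall v, f v \in L v.
    apply: (@fin_all_exists _ (fun=> C) (fun v c => c \in L v)) => v.
    by have [c [_ [cL _ _]]] := two_colors v; exists c.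
  have -> : W = set0 by apply/eqP; rewrite -cards_eq0 -leqn0.
  exists f; split=> // s; apply/negP.
  case: s => [|y [|z s]] // /andP[_ /andP[/= /andP[]]].
  by rewrite inE.
have [->|W0] := eqVneq W set0; first by apply: IHn; rewrite cards0.
have [[v vW n3]|[u [a [b [c [d [x hK]]]]]]] := unavoidable W W0.
  have [|f gf] := IHn (W :\ v); first by rewrite (cardsD1 v) vW in leWn.
  have [|k kL k1] := greedy_color f (W := W :\ v) (v := v).
    apply: leq_trans n3; apply/subset_leq_card/subsetP => w.
    by rewrite !inE => /andP[/andP[_ ->] ->].
  exists (recolor f v k); rewrite -(setD1K vW).
  by apply: good_add => //; rewrite !inE eqxx.
have [|f gf] := IHn (W :\: [set z in [:: u; a; b; c; d; x]]).
  rewrite -ltnS; apply: leq_trans leWn; apply: proper_card; apply/properP.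
  split; first exact: subsetDl.
  by exists u; rewrite ?(house_sub hK) ?inE ?eqxx.
exact: (@house_extends W _ u a b c d x hK erefl f gf).
Qed.

Lemma good_DP_forested_coloring f :
  good [set: V] f -> exists S : {fset V * C}, DP_forested_coloring L H S.
Proof.
case=> fL ff; pose S := [fset (v, f v) | v in V]%fset.
have inS p : (p \in S) = (p.2 == f p.1).
  apply/imfsetP/eqP => [[v _ ->]//|E]; exists p.1 => //.
  by rewrite -E -surjective_pairing.
exists S; split; first split.
- by move=> p; rewrite inS => /eqP E; rewrite inE /= E.
- by rewrite card_imfset //= ?size_enum_ord -?cardE // => v w [].
- move=> p q; rewrite !inS => /eqP Ep /eqP Eq E.
  by rewrite (surjective_pairing p) (surjective_pairing q) Ep Eq E.
move=> s; apply: contra (ff s); rewrite /graph_cycle /ucycleb => /and3P[-> cs ->].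
rewrite andbT /=; apply: sub_cycle cs => v w /=; rewrite !inE /clash.
case/andP => -> /existsP[p /existsP[q /and3P[/eqP Ep /eqP Eq]]].
have /eqP := fsvalP p; have /eqP := fsvalP q.
rewrite !inS => /eqP/eqP Eq2 /eqP/eqP Ep2.
by rewrite (surjective_pairing (val p)) (surjective_pairing (val q)) Ep2 Eq2 Ep Eq.
Qed.

End Coloring.

(** * Discharging on a combinatorial map *)

Section OrbitSums.
Local Open Scope ring_scope.
Variables (D : finType) (f : D -> D).
Hypothesis f_inj : injective f.

Lemma order_shift x : order f (f x) = order f x.
Proof.
by apply: eq_card => y; rewrite !inE -(same_fconnect1 f_inj).
Qed.

Lemma sum_shift (F : D -> rat) : \sum_x F (f x) = \sum_x F x.
Proof. by rewrite [RHS](reindex_inj f_inj). Qed.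

(** An orbit of size m contributes m times 1/m; this turns sums over orbits,
    that is over vertices or faces, into sums over darts. *)
Lemma sum_inverse_order : \sum_x (order f x)%:R^-1 = (fcard f D)%:R :> rat.
Proof.
rewrite (partition_big (froot f) (froots f)) /=; last first.
  by move=> x _; apply: (roots_root (fconnect_sym f_inj)).
rewrite /n_comp_mem -sum1_card natr_sum.
rewrite [RHS](eq_bigl (froots f)); last by move=> x; rewrite !inE andbT.
apply: eq_bigr => r /eqP rr.
rewrite (eq_bigl [in fconnect f r]); last first.
  move=> x; rewrite !inE -{1}rr (root_connect (fconnect_sym f_inj)).
  by rewrite (fconnect_sym f_inj).
rewrite (eq_bigr (fun=> (order f r)%:R^-1)); last first.
  move=> x rx; congr (_%:R^-1); apply: eq_card => y.
  by rewrite !inE -(same_connect (fconnect_sym f_inj) rx).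
rewrite sumr_const (_ : #|_| = order f r); last exact: eq_card.
rewrite -[LHS]mulr_natl mulfV //.
by rewrite pnatr_eq0 -lt0n order_gt0.
Qed.

(** Discharging balances are summed over all darts; where they are not
    nonnegative dart by dart, averaging over orbits of size five suffices. *)
Lemma orbit5_sum_ge0 (Q : pred D) (F : D -> rat) :
  (forall x, Q (f x) = Q x) -> (forall x, ~~ Q x -> 0 <= F x) ->
  (forall x, Q x ->
     0 <= F x + F (f x) + F (f (f x)) + F (f (f (f x))) + F (f (f (f (f x))))) ->
  0 <= \sum_x F x.
Proof.
move=> Qf F0 F5.
pose F2 x := F (f x); pose F3 x := F2 (f x); pose F4 x := F3 (f x).
have : 0 <= \sum_x (F x + F2 x + F3 x + F4 x + F4 (f x)).
  apply: sumr_ge0 => x _; have [Qx|nQx] := boolP (Q x); first exact: F5.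
  by rewrite !addr_ge0 // F0 // ?Qf.
rewrite !big_split /= (sum_shift F4) (sum_shift F3) (sum_shift F2) (sum_shift F).
lra.
Qed.

Lemma iter_order3 x : order f x = 3 -> f (f (f x)) = x.
Proof. by move=> E; rewrite -{2}(iter_order f_inj x) E. Qed.

Lemma iter_order4 x : order f x = 4 -> f (f (f (f x))) = x.
Proof. by move=> E; rewrite -{2}(iter_order f_inj x) E. Qed.

Lemma iter_order5 x : order f x = 5 -> f (f (f (f (f x)))) = x.
Proof. by move=> E; rewrite -{2}(iter_order f_inj x) E. Qed.

(** Charge passed from a dart to its neighbors does not change the total. *)
Lemma sum_transfer (f' : D -> D) (F c c' : D -> rat) : injective f' ->
  \sum_x (F x + (c (f x) + c (f' x) - 2 * c x) + 2 * (c' x - c' (f x)))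
    = \sum_x F x.
Proof.
move=> f'_inj; rewrite big_split big_split -mulr_sumr /= !sumrB big_split /=.
rewrite -mulr_sumr (sum_shift c) (sum_shift c').
have -> : \sum_x c (f' x) = \sum_x c x by rewrite [RHS](reindex_inj f'_inj).
lra.
Qed.

End OrbitSums.

(** A combinatorial map: [sg] sends a dart to the next one, clockwise, with the
    same origin and [al] reverses a dart, so that the orbits of [sg] are the
    vertices, and those of [face_next] the faces, which lie to the left of
    their darts.  A dart also stands for the corner, at its origin, of the face
    to its left. *)
Section Discharging.
Variables (D : finType) (sg al : D -> D).
Hypotheses (sg_inj : injective sg) (alK : involutive al).

Definition face_next (d : D) : D := sg (al d).
Notation ph := face_next.
Notation k := (order sg).
Notation n := (order ph).

Lemma face_next_inj : injective ph.
Proof. by move=> x y /sg_inj /(inv_inj alK). Qed.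

Definition tri (d : D) : bool := n d == 3.

Hypotheses (min_face : forall d, 3 <= n d) (min_degree : forall d, 4 <= k d).
Hypothesis tri_opposite : forall d, tri d -> ~~ tri (al d) /\ n (al d) != 4.
Hypothesis no_house : forall d, n d = 5 ->
  (forall i, k (iter i ph d) = 4) -> tri (al d) -> k (ph (ph (al d))) != 4.

Definition face_prev (d : D) : D := finv ph d.
Notation pi := face_prev.

Lemma face_nextK : cancel ph pi. Proof. exact: finv_f face_next_inj. Qed.
Lemma face_prevK : cancel pi ph. Proof. exact: f_finv face_next_inj. Qed.

Definition vertex_prev (d : D) : D := al (pi d).
Notation sgi := vertex_prev.

Lemma vertex_nextK : cancel sg sgi.
Proof. by move=> d; apply: sg_inj; exact: face_prevK. Qed.
Lemma vertex_prevK : cancel sgi sg.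
Proof. by move=> d; exact: face_prevK. Qed.

Lemma size_face_next d : n (ph d) = n d. Proof. exact: order_shift face_next_inj d. Qed.
Lemma size_face_prev d : n (pi d) = n d.
Proof. by rewrite -{2}(face_prevK d) size_face_next. Qed.
Lemma degree_next d : k (sg d) = k d. Proof. exact: order_shift sg_inj d. Qed.
Lemma degree_face_next d : k (ph d) = k (al d). Proof. exact: degree_next. Qed.
Lemma tri_face_next d : tri (ph d) = tri d. Proof. by rewrite /tri size_face_next. Qed.
Lemma tri_face_prev d : tri (pi d) = tri d. Proof. by rewrite /tri size_face_prev. Qed.
Lemma tri_vertex_next d : tri (sg d) = tri (al d).
Proof. by rewrite -(tri_face_next (al d)) /face_next alK. Qed.

Lemma tri_not_consecutive d : tri d -> ~~ tri (sg d).
Proof. by rewrite tri_vertex_next => /tri_opposite []. Qed.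

Definition big (d : D) : bool := 4 < k d.

Lemma bigE d : big d = (k d != 4).
Proof. by rewrite /big ltn_neqAle eq_sym min_degree andbT. Qed.

Definition face_sum5 (F : D -> bool) (d : D) : nat :=
  F d + F (ph d) + F (ph (ph d)) + F (ph (ph (ph d))) + F (ph (ph (ph (ph d)))).

Lemma face_sum5_next F d : n d = 5 -> face_sum5 F (ph d) = face_sum5 F d.
Proof.
by move=> n5; rewrite /face_sum5 (iter_order5 face_next_inj n5); clear; lia.
Qed.

Definition adjacent_tris := face_sum5 (fun d => tri (al d)).
Definition bigs := face_sum5 big.
Notation t := adjacent_tris.
Notation B := bigs.

(** The 5-faces that cannot pay 2 units to each adjacent triangle; they lack
    twice the excess of [adjacent_tris] over three. *)
Definition needy (d : D) : bool := (n d == 5) && (3 < t d).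

(** A vertex of degree at least five covers the whole deficit of a needy face
    if it is the only such vertex on it, and half of it otherwise. *)
Definition corner_gift (d : D) : nat :=
  if needy d && big d then
    if B d <= 1 then (t d - 3).*2 else t d - 3
  else 0.

(** One unit, given by the apex of a triangle to the needy face across the
    opposite edge when that face has no vertex of degree at least five.  The
    apex gives only if both neighboring edges of that face carry triangles as
    well: then the faces around the apex on both sides of the triangle have a
    second vertex of degree at least five, which halves the other gifts of the
    apex. *)
Definition opposite_gift (d : D) : bool :=
  let d' := al (ph d) in
  [&& tri d, big d, needy d', B d' == 0, tri (al (ph d')) & tri (al (pi d'))].

Notation g := corner_gift.
Notation o := opposite_gift.

Lemma needy_next d : needy (ph d) = needy d.
Proof.
rewrite /needy size_face_next; have [/eqP n5|//] := boolP (n d == 5).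
by rewrite /t face_sum5_next.
Qed.

Lemma face5_prev d : n d = 5 -> ph (ph (ph (ph d))) = pi d.
Proof.
by move=> n5; apply: face_next_inj; rewrite (iter_order5 face_next_inj n5) face_prevK.
Qed.

Lemma opposite_gift_tri d : o d -> tri d.
Proof. by case/and3P. Qed.

Lemma no_big_degrees d : n d = 5 -> B d = 0 -> forall i, k (iter i ph d) = 4.
Proof.
move=> n5 B0 i.
have allB x : n x = 5 -> B x = 0 -> k x = 4.
  move=> _; rewrite /B /face_sum5 => Bx; apply/eqP/negPn; rewrite -bigE.
  by move: Bx; clear; lia.
have [nx Bx] : n (iter i ph d) = 5 /\ B (iter i ph d) = 0.
  elim: i => //= i [IH1 IH2]; rewrite size_face_next; split=> //.
  by rewrite /B face_sum5_next.
exact: allB.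
Qed.

(** The face next to the triangle also passes through the apex of the
    neighboring triangle, since the vertex between the two triangles has degree
    four; that apex has degree at least five because there is no house. *)
Lemma opposite_gift_after d : o (sg d) -> big (ph (ph d)).
Proof.
set T := sg d => /and5P[T3 _ nd /eqP B0 /andP[_ tprev]].
set dl := al (ph T) in nd B0 tprev.
have /andP[/eqP n5 _] := nd.
set ep := pi dl in tprev.
have n5' : n ep = 5 by rewrite size_face_prev.
have B0' : B ep = 0 by rewrite -B0 -[in RHS](face_prevK dl) /B face_sum5_next.
have k4 := no_big_degrees n5' B0'.
have := no_house n5' k4 tprev; rewrite -bigE; congr is_true.
rewrite /big (degree_face_next (ph d)); congr (4 < k _).
have kep : k (al ep) = 4 by rewrite -degree_face_next; exact: (k4 1%N).
have defd : al d = ph (ph T).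
  apply: face_next_inj; rewrite (iter_order3 face_next_inj (eqP T3)).
  by rewrite /face_next alK.
have e1 : al ep = ph (ph (ph (al ep))).
  by rewrite (iter_order3 face_next_inj (eqP tprev)).
apply: (inv_inj alK); rewrite alK.
apply: sg_inj; rewrite -/(ph _) -e1.
have <- : sg (sg (sg dl)) = sg (ph d).
  by rewrite [ph d]/face_next defd.
by rewrite -{1}(iter_order4 sg_inj kep) -[sg (al ep)]/(ph ep) face_prevK.
Qed.

Lemma opposite_gift_before d : o (sgi d) -> big (pi (pi d)).
Proof.
set T := sgi d => /and5P[T3 _ nd /eqP B0 /andP[tnext _]].
set dl := al (ph T) in nd B0 tnext.
have /andP[/eqP n5 _] := nd.
set dn := ph dl in tnext.
have n5' : n dn = 5 by rewrite size_face_next.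
have B0' : B dn = 0 by rewrite -B0 /dn /B face_sum5_next.
have k4 := no_big_degrees n5' B0'.
have := no_house n5' k4 tnext; rewrite -bigE; congr is_true.
have defd : pi d = al T by rewrite /T /vertex_prev alK.
rewrite defd; set z := pi (al T).
have kaT : k (al T) = 4.
  rewrite -degree_face_next -[ph T]alK -/dl -degree_face_next.
  exact: (k4 0%N).
suff e1 : al z = ph (al dn).
  by rewrite /big {1}/face_next -e1 alK degree_next.
apply: sg_inj; rewrite -[LHS]/(ph z) face_prevK.
rewrite {1}/face_next alK -{1}(iter_order4 sg_inj kaT).
by rewrite /dn /dl [ph (al _)]/face_next alK.
Qed.

Lemma opposite_gift_bigs d : n d = 5 -> o (sg d) || o (sgi d) -> 1 < B d.
Proof.
move=> n5; rewrite /B /face_sum5 => oo.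
have bd : big d.
  case/orP: oo => /and3P[_ bo _]; first by rewrite /big degree_next in bo.
  by rewrite /big -(vertex_prevK d) degree_next.
have e3 : pi (pi d) = ph (ph (ph d)).
  by rewrite -(face5_prev n5) face_nextK.
have [/opposite_gift_after b2|/opposite_gift_before b3] := orP oo.
  by rewrite bd b2; clear; lia.
by rewrite e3 in b3; rewrite bd b3; clear; lia.
Qed.

Lemma adjacent_tris_le d : n d = 5 -> t d <= 3 + tri (sg d) + tri (sgi d).
Proof.
move=> n5; rewrite /t /face_sum5 (face5_prev n5) -tri_vertex_next -/(sgi d).
by do 3 case: (tri _) => /=; do 2 case: (tri _).
Qed.

(** The gift to a corner is charged to the triangles on its two sides: each is
    charged at most two units, and at most one if the vertex also gives across
    that triangle. *)
Lemma corner_gift_le d :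
  g d + o (sg d) + o (sgi d) <= (tri (sg d)).*2 + (tri (sgi d)).*2.
Proof.
have o1 : o (sg d) <= tri (sg d) by case: (o _) (@opposite_gift_tri (sg d)) => // ->.
have o2 : o (sgi d) <= tri (sgi d) by case: (o _) (@opposite_gift_tri (sgi d)) => // ->.
rewrite /g; case: ifP => [/andP[/andP[/eqP n5 _] bd]|_]; last first.
  by move: o1 o2; clear; lia.
move: (adjacent_tris_le n5) (opposite_gift_bigs n5) o1 o2.
move: (t d) (B d) (o (sg d)) (o (sgi d)) (tri (sg d)) (tri (sgi d)); clear.
move=> T b o1 o2 t1 t2 le3 b1 le1 le2.
have [oo|oo] := boolP (o1 || o2); last by move: le3 oo; case: ifP; lia.
by rewrite (leqNgt b) b1 //=; lia.
Qed.

Lemma corner_gift_half d : o (sg d) || o (sgi d) -> g d <= 2.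
Proof.
move=> oo; rewrite /g; case: ifP => [/andP[/andP[/eqP n5 _] bd]|//].
have := opposite_gift_bigs n5 oo; rewrite ltnNge => /negPf ->.
move: (adjacent_tris_le n5); do 2 case: (tri _); move: (t d) => T; clear; lia.
Qed.

(** Two consecutive corners that are not triangles are separated by an edge
    [v w] that borders no triangle.  If both receive a gift, then every other
    edge of the two faces borders a triangle.  If [w] had degree four, the two
    triangles at [w] would share an edge; so [w] also contributes to both. *)
Lemma corner_gift_pair d : ~~ tri d -> ~~ tri (sg d) -> 0 < g d -> 0 < g (sg d) ->
  g d <= 1 /\ g (sg d) <= 1.
Proof.
move=> td tsd; rewrite /g.
case: ifP => // /andP[nd bd] _; case: ifP => // /andP[nsd bsd] _.
have /andP[/eqP n5 t4] := nd; have /andP[/eqP n5' t4'] := nsd.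
have t_d := adjacent_tris_le n5; have t_sd := adjacent_tris_le n5'.
rewrite vertex_nextK in t_sd.
have pisd : pi (sg d) = al d.
  by rewrite -{1}(alK d) -/(ph _) face_nextK.
have Bb : big (al d).
  rewrite bigE; apply/eqP => kb.
  have t1 : tri (sg (sg (al d))).
    rewrite tri_vertex_next -/(ph d); move: t4 tsd.
    by rewrite /t /face_sum5 tri_vertex_next; do 5 case: (tri _).
  have t2 : tri (sg (sg (sg (al d)))).
    have -> : sg (sg (sg (al d))) = sgi (al d).
      by apply: sg_inj; rewrite vertex_prevK (iter_order4 sg_inj kb).
    move: t4' td; rewrite /t /face_sum5.
    rewrite (face5_prev n5') /vertex_prev.
    have -> : ph (ph (ph (sg d))) = pi (al d).
      by rewrite -pisd -(face5_prev n5') face_nextK.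
    by rewrite pisd alK; do 5 case: (tri _).
  by have := tri_not_consecutive t1; rewrite t2.
have B1 : 1 < B d.
  by rewrite /B /face_sum5 bd {1}/big degree_face_next -/(big (al d)) Bb.
have B2 : 1 < B (sg d).
  by rewrite /B /face_sum5 bsd (face5_prev n5') pisd Bb; clear; lia.
rewrite (leqNgt (B d)) B1 (leqNgt (B (sg d))) B2 /=; move: t_d t_sd td tsd t4 t4'.
by do 4 case: (tri _) => //=; clear; lia.
Qed.

(** The corners around a vertex of degree five, in cyclic order: [a_i] tells
    whether corner [i] is a triangle, [o_i] and [g_i] are its gifts. *)
Lemma degree5_arith (a0 a1 a2 a3 a4 o0 o1 o2 o3 o4 : bool) (g0 g1 g2 g3 g4 : nat) :
  (forall a b o o' g g', (a, b, o, o', g, g') \in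
     [:: (a0, a1, o4, o1, g0, g1); (a1, a2, o0, o2, g1, g2); (a2, a3, o1, o3, g2, g3);
         (a3, a4, o2, o4, g3, g4); (a4, a0, o3, o0, g4, g0)] ->
     [/\ ~~ (a && b), o || o' -> g <= 2 &
         ~~ a -> ~~ b -> 0 < g -> 0 < g' -> g <= 1 /\ g' <= 1]) ->
  [&& o0 <= a0, o1 <= a1, o2 <= a2, o3 <= a3 & o4 <= a4] ->
  [&& g0 + o1 + o4 <= a1.*2 + a4.*2, g1 + o2 + o0 <= a2.*2 + a0.*2,
      g2 + o3 + o1 <= a3.*2 + a1.*2, g3 + o4 + o2 <= a4.*2 + a2.*2 &
      g4 + o0 + o3 <= a0.*2 + a3.*2] ->
  (g0 + o0) + (g1 + o1) + (g2 + o2) + (g3 + o3) + (g4 + o4) <= 6.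
Proof.
move=> h /and5P[? ? ? ? ?] /and5P[? ? ? ? ?].
have [n0 h0 p0] : _ := h a0 a1 o4 o1 g0 g1 (mem_head _ _).
have [n1 h1 p1] : _ := h a1 a2 o0 o2 g1 g2 ltac:(by rewrite !inE eqxx ?orbT).
have [n2 h2 p2] : _ := h a2 a3 o1 o3 g2 g3 ltac:(by rewrite !inE eqxx ?orbT).
have [n3 h3 p3] : _ := h a3 a4 o2 o4 g3 g4 ltac:(by rewrite !inE eqxx ?orbT).
have [n4 h4 p4] : _ := h a4 a0 o3 o0 g4 g0 ltac:(by rewrite !inE eqxx ?orbT).
clear h; destruct a0, a1, a2, a3, a4; simpl in *; try discriminate; lia.
Qed.

Lemma degree5_gifts d : k d = 5 ->
  let s1 := sg d in let s2 := sg s1 in let s3 := sg s2 in let s4 := sg s3 in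
  (g d + o d) + (g s1 + o s1) + (g s2 + o s2) + (g s3 + o s3) + (g s4 + o s4) <= 6.
Proof.
move=> k5 /=; set s1 := sg d; set s2 := sg s1; set s3 := sg s2; set s4 := sg s3.
have e0 : sg s4 = d := iter_order5 sg_inj k5.
have p0 : sgi d = s4 by rewrite -e0 vertex_nextK.
have [p1 p2 p3 p4] : [/\ sgi s1 = d, sgi s2 = s1, sgi s3 = s2 & sgi s4 = s3].
  by split; rewrite vertex_nextK.
have le x : o x <= tri x by case: (o _) (@opposite_gift_tri x) => // ->.
rewrite /=; apply: (@degree5_arith (tri d) (tri s1) (tri s2) (tri s3) (tri s4));
  last 2 first.
- by rewrite !le.
- have := (corner_gift_le d, corner_gift_le s1, corner_gift_le s2,
    corner_gift_le s3, corner_gift_le s4).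
  by rewrite e0 p0 p1 p2 p3 p4 => -[[[[-> ->] ->] ->] ->].
have step x y z : sgi x = z -> sg x = y ->
    [/\ ~~ (tri x && tri y), o z || o y -> g x <= 2 &
      ~~ tri x -> ~~ tri y -> 0 < g x -> 0 < g y -> g x <= 1 /\ g y <= 1].
  move=> <- <-; split.
  - by have := @tri_not_consecutive x; case: (tri x) => // /(_ isT).
  - by rewrite orbC; apply: corner_gift_half.
  - exact: corner_gift_pair.
move=> a b z y x x'; rewrite !inE => /or4P[| | |/orP[]] /eqP[-> -> -> -> -> ->];
  exact: step.
Qed.

(** If the face has no vertex of degree at least five, it receives one unit
    across each edge whose two neighbors carry triangles too: five units for a
    deficit of four, or two units for a deficit of two. *)
Lemma needy_face_gifts d : n d = 5 ->
  let r x := o (pi (al x)) in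
  let s1 := ph d in let s2 := ph s1 in let s3 := ph s2 in let s4 := ph s3 in
  (t d).*2 <= 6 + (g d + r d) + (g s1 + r s1) + (g s2 + r s2) + (g s3 + r s3)
                + (g s4 + r s4).
Proof.
move=> n5 /=; pose r x := o (pi (al x)).
set s1 := ph d; set s2 := ph s1; set s3 := ph s2; set s4 := ph s3.
rewrite -!/(r _).
have [t3|t4] := leqP (t d) 3; first lia.
have s5 : ph s4 = d := iter_order5 face_next_inj n5.
have nd : needy d by rewrite /needy n5 t4.
have inv x : n x = 5 -> [/\ n (ph x) = 5, needy (ph x) = needy x, t (ph x) = t x &
    B (ph x) = B x].
  by move=> nx; rewrite size_face_next needy_next /t /B !face_sum5_next.
have [n1 d1 t1 B1] := inv _ n5; have [n2 d2 t2 B2] := inv _ n1.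
have [n3 d3 t3 B3] := inv _ n2; have [n4 d4 t4' B4] := inv _ n3.
have [B0|Bpos] := posnP (B d); last first.
  rewrite /g !(B4, B3, B2, B1, d4, d3, d2, d1, t4', t3, t2, t1) nd /=.
  have : B d = big d + big s1 + big s2 + big s3 + big s4 by [].
  move: Bpos t4; move: (t d) (B d) (r d) (r s1) (r s2) (r s3) (r s4).
  move=> T b ? ? ? ? ? b0 T3 Eb.
  case: (leqP b 1) => b1; move: b0 T3 Eb b1;
    case: (big d); case: (big s1); case: (big s2); case: (big s3); case: (big s4);
    rewrite /=; clear; lia.
have gives x : n x = 5 -> needy x -> B x = 0 ->
    tri (al x) + tri (al (ph x)) + tri (al (pi x)) <= 2 + r x.
  move=> nx dx Bx; rewrite /r /o face_prevK alK dx Bx tri_face_prev eqxx /=.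
  case ax: (tri (al x)); last by do 2 case: (tri _).
  have -> : big (pi (al x)).
    have <- : ph (ph (al x)) = pi (al x).
      by apply: face_next_inj; rewrite face_prevK (iter_order3 face_next_inj (eqP ax)).
    rewrite bigE; apply: no_house => //; exact: no_big_degrees.
  by do 2 case: (tri _).
have gd := gives _ n5 nd B0.
have g1 := gives _ n1 (etrans d1 nd) (etrans B1 B0).
have g2 := gives _ n2 (etrans d2 (etrans d1 nd)) (etrans B2 (etrans B1 B0)).
have g3 := gives _ n3 (etrans d3 (etrans d2 (etrans d1 nd)))
  (etrans B3 (etrans B2 (etrans B1 B0))).
have g4 := gives _ n4 (etrans d4 (etrans d3 (etrans d2 (etrans d1 nd))))
  (etrans B4 (etrans B3 (etrans B2 (etrans B1 B0)))).
move: gd g1 g2 g3 g4; rewrite -(face5_prev n5) !face_nextK.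
rewrite -/s1 -/s2 -/s3 -/s4 s5.
have : t d = tri (al d) + tri (al s1) + tri (al s2) + tri (al s3) + tri (al s4) by [].
move: t4; move: (t d) => T; move: (g d) (g s1) (g s2) (g s3) (g s4) => ? ? ? ? ?.
move: (r d) (r s1) (r s2) (r s3) (r s4).
case: (tri (al d)); case: (tri (al s1)); case: (tri (al s2)); case: (tri (al s3));
 case: (tri (al s4)); clear; move=> ? ? ? ? ? /=; lia.
Qed.

Section Totals.
Local Open Scope ring_scope.

Let q (m : nat) : rat := m%:R.

Lemma inv_le (m p : nat) : (0 < p)%N -> (p <= m)%N -> (q m)^-1 <= (q p)^-1.
Proof.
move=> p0 pm; have m0 : (0 < m)%N by exact: leq_trans pm.
by rewrite lef_pV2 ?posrE ?ltr0n // ler_nat.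
Qed.

(** For degree at least six, each triangle costs at most four units, and no two
    consecutive corners are triangles; half of the cost is moved to a
    neighboring corner, so that each corner pays at most two units.  The surplus
    6(k-4) amounts to at least two units per corner. *)
Lemma vertex_total :
  0 <= \sum_d (6%:R - 24%:R * (q (k d))^-1 - q (g d) - q (o d)).
Proof.
pose F d : rat := 6%:R - 24%:R * (q (k d))^-1 - q (g d) - q (o d).
pose S d : rat := (5 < k d)%N%:R.
pose c1 d : rat := S d * (2 * q (tri d) - q (o d)).
pose c2 d : rat := S d * q (tri d).
rewrite -(sum_transfer sg_inj F c1 c2 (can_inj vertex_prevK)).
apply: (@orbit5_sum_ge0 _ sg sg_inj (fun d => k d == 5%N)).
- by move=> d; rewrite degree_next.
- move=> d k5.
  have kk : S (sg d) = S d /\ S (sgi d) = S d.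
    by rewrite /S degree_next -(degree_next (sgi d)) vertex_prevK.
  rewrite /c1 /c2; case: kk => -> ->.
  have o1 : (o d <= tri d)%N by case: (o _) (@opposite_gift_tri d) => // ->.
  have nc := @tri_not_consecutive d.
  rewrite /F /S; have [k6|k6] := ltnP 5 (k d).
    have := inv_le (isT : (0 < 6)%N) k6; have := corner_gift_le d.
    rewrite -(ler_nat rat) !natrD -!muln2 !natrM -!/(q _).
    have : q (o d) <= q (tri d) by rewrite ler_nat.
    have : q (tri d) + q (tri (sg d)) <= 1.
      by rewrite -natrD lern1; case: (tri d) nc => [/(_ isT) /negPf ->|_]; case: (tri _).
    have : (0 : rat) <= q (o d) by rewrite ler0n.
    rewrite /q /=; lra.
  have k4 : k d = 4 by move: (min_degree d) k5 k6; lia.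
  have -> : g d = 0%N by rewrite /g /big k4 andbF.
  have -> : o d = false by rewrite /o /big k4 andbF.
  rewrite /q k4 /=; lra.
move=> d /eqP k5; rewrite /c1 /c2 /S !degree_next -(degree_next (sgi d)).
rewrite !vertex_nextK vertex_prevK !degree_next k5 /= !mul0r.
have := degree5_gifts k5; rewrite /= -(ler_nat rat) !natrD /F !degree_next k5 /q.
lra.
Qed.

(** The shift between [opposite_gift] and its occurrence in the balance of the
    receiving face, and the payments to triangles, are transfers. *)
Lemma face_total :
  0 <= \sum_d (6%:R - 24%:R * (q (n d))^-1 + q (g d) + q (o d)).
Proof.
pose r d := o (pi (al d)).
have pi_al_inj : injective (fun d => pi (al d)).
  exact: inj_comp (can_inj face_prevK) (inv_inj alK).
rewrite big_split -(sum_shift pi_al_inj (fun d => q (o d))) -big_split /=.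
rewrite -(sum_transfer (inv_inj alK) _ (fun=> 0) (fun d => q (tri d)) (inv_inj alK)).
rewrite (eq_bigr (fun d => 6 - 24 / q (n d) + q (g d) + q (r d)
  + 2 * (q (tri d) - q (tri (al d))))); last by move=> d _ /=; rewrite /r; ring.
apply: (@orbit5_sum_ge0 _ ph face_next_inj (fun d => n d == 5%N)).
- by move=> d; rewrite size_face_next.
- move=> d n5.
  have [g0 r0] : 0 <= q (g d) /\ 0 <= q (r d) by rewrite !ler0n.
  have t0 : 0 <= q (tri d) by rewrite ler0n.
  have [td|ntd] := boolP (tri d).
    have [/negPf -> _] := tri_opposite td.
    by rewrite (eqP td) /q /=; move: g0 r0; rewrite /q; lra.
  have [ta|nta] := boolP (tri (al d)).
    have [_] := tri_opposite ta; rewrite alK => n4.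
    have n6 : (6 <= n d)%N by move: (min_face d) n4 n5 ntd; rewrite /tri; lia.
    by move: (inv_le (isT : (0 < 6)%N) n6) g0 r0; rewrite /q /=; lra.
  have n4 : (4 <= n d)%N by move: (min_face d) ntd; rewrite /tri; lia.
  by move: (inv_le (isT : (0 < 4)%N) n4) g0 r0; rewrite /q /=; lra.
move=> d /eqP n5; have := needy_face_gifts n5; rewrite /= -!/(r _).
rewrite -(ler_nat rat) -muln2 natrM !natrD !size_face_next !tri_face_next n5.
have -> : tri d = false by rewrite /tri n5.
rewrite /t /face_sum5 ?natrD /q /=; lra.
Qed.

(** The two totals add up to twelve units per dart, minus twenty-four for each
    vertex and each face. *)
Lemma euler_defect : (2 * (fcard sg D + fcard ph D) <= #|D|)%N.
Proof.
have := addr_ge0 vertex_total face_total; rewrite -big_split /=.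
rewrite (eq_bigr (fun d => 12%:R - 24%:R * ((q (k d))^-1 + (q (n d))^-1))); last first.
  by move=> d _; lra.
have twelve : \sum_(d : D) (12%:R : rat) = 12%:R * #|D|%:R.
  by rewrite sumr_const mulr_natr.
rewrite sumrB -mulr_sumr twelve big_split /q /=.
rewrite (sum_inverse_order sg_inj) (sum_inverse_order face_next_inj).
by rewrite -(ler_nat rat) natrM natrD; lra.
Qed.

End Totals.
End Discharging.

(** * Regions of a plane straight-line graph *)

(** Identifying two points lowers the number of classes by at most one. *)
Lemma merge_classes (N : finType) (ls : seq (N * N)) :
  exists2 cls : N -> N, {in ls, forall l, cls l.1 = cls l.2} &
    #|N| <= size ls + #|[set cls x | x : N]|.
Proof.
elim: ls => [|[x y] ls [cls cls_eq cls_card]] /=.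
  exists id => //; rewrite add0n.
  by rewrite card_imset // cardsT.
pose glue z := if z == cls x then cls y else z.
exists (glue \o cls) => [l|].
  rewrite inE => /predU1P[->|/cls_eq E] /=; last by rewrite E.
  by rewrite /glue eqxx; case: ifP.
apply: leq_trans cls_card _; rewrite addSnnS leq_add2l.
rewrite (cardsD1 (cls x)) imset_f // add1n ltnS.
apply/subset_leq_card/subsetP => z; rewrite !inE => /andP[zx /imsetP[w _ Ez]].
apply/imsetP; exists w => //=.
by rewrite /glue -Ez (negPf zx).
Qed.

Section NextSorted.
Variables (T : eqType) (le : rel T).
Hypothesis le_trans : transitive le.

(** In a cyclically read sorted sequence, either nothing lies between an element
    and its successor, or the element is the last and the successor the first. *)
Lemma next_in_sorted s x : uniq s -> sorted le s -> x \in s ->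
  (next s x != x /\ le x (next s x) /\ {in s, forall z, z != x -> z != next s x ->
       le z x \/ le (next s x) z}) \/
  {in s, forall z, (z != x -> le z x) /\ (z != next s x -> le (next s x) z)}.
Proof.
move=> us ss xs; rewrite sorted_pairwise // in ss.
move: us ss; case/splitPr: xs => s1 [|y s2] us ss.
  right; have -> : next (s1 ++ [:: x]) x = head x (s1 ++ [:: x]).
    rewrite next_nth mem_cat mem_head orbT.
    move: us; rewrite cat_uniq /= orbF => /and3P[us1 xs1 _].
    case: s1 us1 xs1 {ss} => [|z s1] /=; first by rewrite eqxx.
    move=> _; rewrite inE negb_or => /andP[xz xs1].
    rewrite eq_sym (negPf xz) index_cat (negPf xs1) /= eqxx addn0.
    by rewrite nth_default // size_cat addn1.
  move: ss; rewrite pairwise_cat => /and3P[/allrelP r1 p1 _] z.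
  rewrite mem_cat inE => zs; split=> [zx|].
    by apply: r1; rewrite ?mem_head //; move: zs; rewrite (negPf zx) orbF.
  case: s1 {us} r1 p1 zs => [|w s1] /= r1 p1; first by move=> /eqP ->; rewrite eqxx.
  case/andP: p1 => /allP w1 _.
  by rewrite inE -orbA => /or3P[->//|/w1 //|/eqP ->] _; apply: r1; rewrite ?mem_head.
left; have -> : next (s1 ++ x :: y :: s2) x = y.
  rewrite next_nth mem_cat mem_head orbT.
  move: us; rewrite cat_uniq /= !negb_or => /and3P[us1 /and3P[xs1 _ _] _].
  case: s1 us1 xs1 {ss} => [|z s1] /=; first by rewrite eqxx.
  move=> _; rewrite inE negb_or => /andP[xz xs1].
  rewrite eq_sym (negPf xz) index_cat (negPf xs1) /= eqxx addn0.
  by rewrite nth_cat ltnNge leqnSn /= subSnn.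
move: us ss; rewrite cat_uniq pairwise_cat => /and3P[_ _ /andP[xys _]].
case/and3P => /allrelP r1 _ /= /andP[/andP[xy _] /andP[/allP ys _]].
split; [|split] => //; first by apply: contraNneq xys => ->; rewrite mem_head.
move=> z; rewrite mem_cat !inE => /or4P[zs1|/eqP->|/eqP->|zs2]; rewrite ?eqxx //.
  by left; apply: r1; rewrite ?mem_head.
by right; apply: ys.
Qed.

End NextSorted.

(** The points of index [i < np] have increasing abscissas [X i]; a side [s] is
    the graph of an affine function between the points [lft s] and [rgt s].
    Strip [i] is the vertical strip between the points [i] and [i.+1]; in it
    the sides are totally ordered by height, which is measured at [mid i]. *)
Section Strips.
Local Open Scope ring_scope.
Variables (R : realFieldType) (S : finType).
Variables (slope offset : S -> R) (lft rgt : S -> nat).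
Variables (np : nat) (X Y : nat -> R).

Definition height (s : S) (x : R) : R := slope s * x + offset s.

Hypotheses (lft_rgt : forall s, (lft s < rgt s)%N) (rgt_np : forall s, (rgt s < np)%N).
Hypothesis X_incr : forall i j, (i < j)%N -> (j < np)%N -> X i < X j.
Hypotheses (height_lft : forall s, height s (X (lft s)) = Y (lft s))
           (height_rgt : forall s, height s (X (rgt s)) = Y (rgt s)).
Hypothesis no_crossing : forall s s' x, s != s' ->
  X (lft s) <= x <= X (rgt s) -> X (lft s') <= x <= X (rgt s') ->
  height s x = height s' x ->
  (x = X (lft s) \/ x = X (rgt s)) /\ (x = X (lft s') \/ x = X (rgt s')).
Hypothesis no_isolated : forall i, (i < np)%N -> exists s, lft s = i \/ rgt s = i.

Definition crosses (s : S) (i : nat) : bool := (lft s <= i < rgt s)%N.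
Definition passes (s : S) (i : nat) : bool := (lft s < i < rgt s)%N.
Definition mid (i : nat) : R := (X i + X i.+1) / 2.
Notation h s i := (height s (mid i)).

Lemma X_le i j : (i <= j)%N -> (j < np)%N -> X i <= X j.
Proof. by rewrite leq_eqVlt => /predU1P[->//|ij /(X_incr ij)/ltW]. Qed.

Lemma mid_strip i : (i.+1 < np)%N -> X i < mid i < X i.+1.
Proof. by move=> /(X_incr (ltnSn i)); rewrite /mid => ?; apply/andP; split; lra. Qed.

Lemma crosses_np s i : crosses s i -> (i.+1 < np)%N.
Proof. by case/andP => _ ib; apply: leq_ltn_trans ib (rgt_np s). Qed.

Lemma crosses_span s i x : crosses s i -> X i <= x <= X i.+1 ->
  X (lft s) <= x <= X (rgt s).
Proof.
move=> cs /andP[ix xi]; have np_i := crosses_np cs; case/andP: cs => ai ib.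
by rewrite (le_trans (X_le ai (ltnW np_i)) ix) (le_trans xi (X_le ib (rgt_np s))).
Qed.

(** Two sides that change order meet inside the strip, but sides may only meet
    at points, and those lie on the boundary of the strip. *)
Lemma crossing_order s s' i x y : s != s' -> crosses s i -> crosses s' i ->
  X i < x < X i.+1 -> X i <= y <= X i.+1 ->
  height s x < height s' x -> height s y <= height s' y.
Proof.
move=> ss cs cs' /andP[ix xi] /andP[iy yi] lt_x; rewrite leNgt; apply/negP => lt_y.
pose d z := height s' z - height s z.
have dx : 0 < d x by rewrite subr_gt0.
have dy : 0 < - d y by rewrite oppr_gt0 subr_lt0.
have pos : 0 < d x - d y by lra.
(* The affine function [d] vanishes at [z = x + r (y - x)]. *)
pose r := d x / (d x - d y).
have r0 : 0 < r by rewrite divr_gt0.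
have r1 : r < 1 by rewrite ltr_pdivrMr // mul1r; lra.
pose z := x + r * (y - x).
have dz : d z = 0.
  have -> : d z = d x - r * (d x - d y) by rewrite /d /z /height; ring.
  by rewrite /r divfK ?subrr // gt_eqF.
have [z1 z2] : X i < z /\ z < X i.+1.
  by rewrite /z; split; nra.
have zs : X i <= z <= X i.+1 by rewrite !ltW.
have E : height s z = height s' z by apply/eqP; rewrite eq_sym -subr_eq0 -/(d z) dz.
have [[Ez|Ez] _] := no_crossing ss (crosses_span cs zs) (crosses_span cs' zs) E.
  have /andP[ai _] := cs; have := X_le ai (ltnW (crosses_np cs)).
  by rewrite -Ez leNgt z1.
by have /andP[_ ib] := cs; have := X_le ib (rgt_np s); rewrite -Ez leNgt z2.
Qed.

Lemma crossing_distinct s s' i : s != s' -> crosses s i -> crosses s' i ->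
  h s i != h s' i.
Proof.
move=> ss cs cs'; apply/eqP => E.
have npi := crosses_np cs; have /andP[m1 m2] := mid_strip npi.
have ms : X i <= mid i <= X i.+1 by rewrite !ltW.
have [[Ez|Ez] _] := no_crossing ss (crosses_span cs ms) (crosses_span cs' ms) E.
  have /andP[ai _] := cs; have := X_le ai (ltnW npi).
  by rewrite -Ez leNgt m1.
by have /andP[_ ib] := cs; have := X_le ib (rgt_np s); rewrite -Ez leNgt m2.
Qed.

Lemma strip_to_edge s s' i y : crosses s i -> crosses s' i ->
  X i <= y <= X i.+1 -> h s i < h s' i -> height s y <= height s' y.
Proof.
move=> cs cs' yi lt; have ss : s != s' by apply: contraTneq lt => ->; rewrite ltxx.
exact: crossing_order ss cs cs' (mid_strip (crosses_np cs)) yi lt.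
Qed.

Lemma edge_to_strip s s' i y : crosses s i -> crosses s' i ->
  X i <= y <= X i.+1 -> height s y < height s' y -> h s i < h s' i.
Proof.
move=> cs cs' yi lt; have ss : s != s' by apply: contraTneq lt => ->; rewrite ltxx.
rewrite lt_neqAle crossing_distinct // leNgt; apply/negP => lt'.
by have := strip_to_edge cs' cs yi lt'; rewrite leNgt lt.
Qed.

Lemma Xi_strip i : (i.+1 < np)%N -> X i <= X i <= X i.+1.
Proof. by move=> ni; rewrite lexx X_le. Qed.

Lemma XSi_strip i : (i.+1 < np)%N -> X i <= X i.+1 <= X i.+1.
Proof. by move=> ni; rewrite lexx X_le. Qed.

Lemma passes_inside s i : passes s i -> X (lft s) < X i < X (rgt s).
Proof.
by case/andP => ai ib; rewrite !X_incr // (ltn_trans ib).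
Qed.

Lemma passing_distinct s s' i : s != s' -> passes s i ->
  (lft s' <= i <= rgt s')%N -> height s (X i) != height s' (X i).
Proof.
move=> ss ps /andP[ai ib]; apply/eqP => E.
have /andP[l r] := passes_inside ps.
have ni : (i < np)%N by apply: leq_ltn_trans ib (rgt_np s').
have li : X (lft s) <= X i <= X (rgt s) by rewrite !ltW.
have li' : X (lft s') <= X i <= X (rgt s') by rewrite !X_le.
have [[Ex|Ex] _] := no_crossing ss li li' E.
  by rewrite Ex ltxx in l.
by rewrite Ex ltxx in r.
Qed.

Lemma passing_off_point s i : passes s i -> height s (X i) != Y i.
Proof.
move=> ps; have /andP[l r] := ps.
have [s' s'i] := no_isolated (ltn_trans r (rgt_np s)).
have ss : s != s'.
  by apply: contraTneq ps => ->; case: s'i => <-; rewrite /passes ltnn ?andbF.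
have -> : Y i = height s' (X i) by case: s'i => <-; rewrite ?height_lft ?height_rgt.
apply: passing_distinct => //.
by case: s'i => <-; rewrite leqnn ?andbT ltnW.
Qed.

(** The region between two consecutive sides of a strip is represented by the
    lower side, and the bottom region by [None]; [top P i] is the region just
    above the highest of the sides in [P]. *)
Definition top (P : pred S) (i : nat) : option S :=
  [pick s | P s && [forall s', P s' ==> (h s' i <= h s i)]].

Lemma top_eq P P' i : P =1 P' -> top P i = top P' i.
Proof.
move=> E; apply: eq_pick => s; rewrite E; congr (_ && _).
by apply: eq_forallb => s'; rewrite E.
Qed.

Lemma top_exists (P : pred S) i s0 : P s0 ->
  exists s, [/\ top P i = Some s, P s & forall s', P s' -> h s' i <= h s i].
Proof.
move=> Ps0; rewrite /top; case: pickP => [s /andP[Ps /forallP max]|none].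
  by exists s; split=> // s' Ps'; have := max s'; rewrite Ps'.
have [s Ps max] := @Order.TotalTheory.arg_maxP _ _ _ s0 P (fun s => h s i) Ps0.
have := none s; rewrite Ps /= => /negP[]; apply/forallP => s'.
by apply/implyP => /max.
Qed.

Lemma top_unique (P : pred S) i s : {in P, forall s', crosses s' i} -> P s ->
  (forall s', P s' -> h s' i <= h s i) -> top P i = Some s.
Proof.
move=> Pc Ps max; have [s1 [-> Ps1 max1]] := top_exists i Ps.
congr Some; apply/eqP/negPn/negP => ss.
have := crossing_distinct ss (Pc _ Ps1) (Pc _ Ps).
by rewrite eq_le max // max1.
Qed.

Lemma top_none (P : pred S) i : (forall s, ~~ P s) -> top P i = None.
Proof.
by move=> none; rewrite /top; case: pickP => // s; rewrite (negPf (none s)).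
Qed.

Lemma top_sub (P P' : pred S) i s0 : {in P, forall s, crosses s i} ->
  subpred P' P -> P' s0 ->
  (forall s s', P s -> ~~ P' s -> P' s' -> h s i <= h s' i) ->
  top P i = top P' i.
Proof.
move=> Pc sub P's0 lower; have [s [-> P's max]] := top_exists i P's0.
apply: top_unique => // [|s' Ps']; first exact: sub.
by have [/max//|/lower] := boolP (P' s'); apply.
Qed.

Lemma passes_crosses s i : passes s i.+1 -> crosses s i /\ crosses s i.+1.
Proof.
by case/andP => l r; split; apply/andP; split=> //; [exact: ltnW r|exact: ltnW l].
Qed.

Lemma top_pass (P : pred S) i : {in P, forall s, passes s i.+1} ->
  top P i = top P i.+1.
Proof.
move=> Pp; have [none|] := boolP [forall s, ~~ P s].
  by rewrite !top_none // => s; apply: (forallP none).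
rewrite negb_forall => /existsP[s0]; rewrite negbK => Ps0.
have [s [-> Ps max]] := top_exists i.+1 Ps0.
have [cs cs'] := passes_crosses (Pp _ Ps).
apply: top_unique => // [s' Ps'|s' Ps']; first by have [] := passes_crosses (Pp _ Ps').
have [ds ds'] := passes_crosses (Pp _ Ps').
rewrite leNgt; apply/negP => lt.
have ss : s != s' by apply: contraTneq lt => ->; rewrite ltxx.
have le := strip_to_edge cs ds (XSi_strip (crosses_np cs)) lt.
have pd : height s (X i.+1) != height s' (X i.+1).
  have := Pp _ Ps; move=> ps; apply: (passing_distinct ss ps).
  by have /andP[l r] := Pp _ Ps'; rewrite (ltnW l) (ltnW r).
have lt' : height s (X i.+1) < height s' (X i.+1) by rewrite lt_neqAle pd.
have := edge_to_strip cs' ds' (Xi_strip (crosses_np cs')) lt'.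
by rewrite ltNge max.
Qed.

Definition below (s : S) (i : nat) : option S :=
  top [pred g | crosses g i & h g i < h s i] i.
(** The regions to the left and to the right of the vertical segment that starts
    at the point [i] and goes up to the next side. *)
Definition left_link (i : nat) : option S :=
  top [pred g | (lft g < i <= rgt g)%N & height g (X i) <= Y i] i.-1.
Definition right_link (i : nat) : option S :=
  top [pred g | (lft g <= i < rgt g)%N & height g (X i) <= Y i] i.
Definition under (i : nat) : option S :=
  top [pred g | passes g i & height g (X i) < Y i] i.

(** While one moves along a side [s], the region below [s] can change only at a
    point that is directly below [s], and there it changes from the left link
    to the right link of that point. *)
Lemma below_pass s i : passes s i.+1 ->
  below s i = below s i.+1 \/
  below s i = left_link i.+1 /\ below s i.+1 = right_link i.+1.
Proof.
move=> ps; have [cs cs'] := passes_crosses ps.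
have xl := XSi_strip (crosses_np cs); have xr := Xi_strip (crosses_np cs').
set x := X i.+1 in xl xr.
pose low g := height g x < height s x.
have lowL g : crosses g i -> (h g i < h s i) = low g.
  move=> cg; apply/idP/idP => [lt|]; last exact: edge_to_strip.
  rewrite /low lt_neqAle (strip_to_edge cg cs xl lt) andbT eq_sym.
  have /andP[l r] := cg; rewrite passing_distinct ?(ltnW l) //.
  + by apply: contraTneq lt => ->; rewrite ltxx.
  + by rewrite (leq_trans l) //= .
have lowR g : crosses g i.+1 -> (h g i.+1 < h s i.+1) = low g.
  move=> cg; apply/idP/idP => [lt|]; last exact: edge_to_strip.
  rewrite /low lt_neqAle (strip_to_edge cg cs' xr lt) andbT eq_sym.
  have /andP[l r] := cg; rewrite passing_distinct //.
  + by apply: contraTneq lt => ->; rewrite ltxx.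
  + by rewrite l ltnW.
have endL g : crosses g i -> ~~ passes g i.+1 -> height g x = Y i.+1.
  case/andP=> l r; rewrite /passes ltnS l /= -leqNgt => r'.
  have E : rgt g = i.+1 by apply/eqP; rewrite eqn_leq r' r.
  by rewrite /x -E height_rgt.
have endR g : crosses g i.+1 -> ~~ passes g i.+1 -> height g x = Y i.+1.
  case/andP=> l r; rewrite /passes r andbT -leqNgt => l'.
  have E : lft g = i.+1 by apply/eqP; rewrite eqn_leq l' l.
  by rewrite /x -E height_lft.
pose Q := [pred g | passes g i.+1 & low g && (Y i.+1 < height g x)].
have cross_pass g : passes g i.+1 -> crosses g i && crosses g i.+1.
  by case/passes_crosses => -> ->.
have [ysx|] := ltP (height s x) (Y i.+1).
  left; rewrite /below.
  rewrite (@top_eq _ [pred g | passes g i.+1 & low g]) => [|g /=].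
    rewrite top_pass => [|g /andP[]//]; apply: top_eq => g /=.
    have [cg|ncg] := boolP (crosses g i.+1).
      rewrite lowR //=; have [//|np_g] := boolP (passes g i.+1).
      by rewrite /low (endR g) //= ltNge (ltW ysx).
    by apply/negbTE; apply: contra ncg => /andP[/cross_pass/andP[]].
  have [cg|ncg] := boolP (crosses g i).
    rewrite lowL //=; have [//|np_g] := boolP (passes g i.+1).
    by rewrite /low (endL g) //= ltNge (ltW ysx).
  by apply/esym/negbTE; apply: contra ncg => /andP[/cross_pass/andP[]].
rewrite le_eqVlt => /predU1P[E|ysx].
  by have := passing_off_point ps; rewrite -/x -E eqxx.
(* [Q]: the sides that separate the point from [s] on its vertical line. *)
have [/existsP[q Qq]|noQ] := boolP [exists q, Q q].
  left; rewrite /below.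
  rewrite (@top_sub _ Q i q) //=; first last.
  - move=> g g' /andP[cg lg]; rewrite (lowL g cg) in lg; rewrite lg /= => ng.
    case/and3P => pg' _ yg'; apply/ltW.
    have /andP[cg' _] := cross_pass _ pg'.
    apply: (edge_to_strip cg cg' xl); apply: le_lt_trans yg'.
    have [pg|npg] := boolP (passes g i.+1); last by rewrite (endL g).
    by move: ng; rewrite pg /= -leNgt.
  - by move=> g /and3P[/cross_pass/andP[cg _] lg _] /=; rewrite cg lowL.
  - by move=> g /andP[].
  rewrite top_pass => [|g /andP[]//].
  apply/esym/(@top_sub _ Q i.+1 q) => //=.
  - by move=> g /andP[].
  - by move=> g /and3P[/cross_pass/andP[_ cg] lg _] /=; rewrite cg lowR.
  move=> g g' /andP[cg lg]; rewrite (lowR g cg) in lg; rewrite lg /= => ng.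
  case/and3P => pg' _ yg'; apply/ltW.
  have /andP[_ cg'] := cross_pass _ pg'.
  apply: (edge_to_strip cg cg' xr); apply: le_lt_trans yg'.
  have [pg|npg] := boolP (passes g i.+1); last by rewrite (endR g).
  by move: ng; rewrite pg /= -leNgt.
right; have lowE g : crosses g i || crosses g i.+1 -> low g = (height g x <= Y i.+1).
  move=> cg; apply/idP/idP => [lg|yg]; last exact: le_lt_trans ysx.
  rewrite leNgt; apply: contra noQ => yg; apply/existsP; exists g.
  rewrite inE lg yg !andbT; apply/negPn/negP => npg.
  by case/orP: cg => [/endL|/endR] /(_ npg) E; rewrite E ltxx in yg.
split; apply: top_eq => g /=; rewrite -/x.
  have [cg|ncg] := boolP (crosses g i).
    by rewrite lowL // lowE ?cg // ltnS; have /andP[-> ->] := cg.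
  by rewrite ltnS -[X in _ = X && _]/(crosses g i) (negPf ncg).
have [cg|ncg] := boolP (crosses g i.+1).
  by rewrite lowR // lowE ?cg ?orbT //; have /andP[-> ->] := cg.
by rewrite -[X in _ = X && _]/(crosses g i.+1) (negPf ncg).
Qed.

Lemma mid_right i : (i.+1 < np)%N -> 0 < mid i - X i.
Proof. by case/mid_strip/andP => ? _; rewrite subr_gt0. Qed.

Lemma mid_left i : (i.+1 < np)%N -> 0 < X i.+1 - mid i.
Proof. by case/mid_strip/andP => _ ?; rewrite subr_gt0. Qed.

Lemma right_heights s s' i : lft s = i -> lft s' = i ->
  (h s i <= h s' i) = (slope s <= slope s').
Proof.
move=> ls ls'; have ni : (i.+1 < np)%N.
  by rewrite -ls; apply: leq_ltn_trans (rgt_np s).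
have E g : lft g = i -> h g i = Y i + slope g * (mid i - X i).
  by move=> lg; rewrite -lg -height_lft /height; ring.
by rewrite !E // lerD2l ler_pM2r ?mid_right.
Qed.

Lemma left_heights s s' i : rgt s = i.+1 -> rgt s' = i.+1 ->
  (h s i <= h s' i) = (slope s' <= slope s).
Proof.
move=> rs rs'; have ni : (i.+1 < np)%N by rewrite -rs.
have E g : rgt g = i.+1 -> h g i = Y i.+1 - slope g * (X i.+1 - mid i).
  by move=> rg; rewrite -rg -height_rgt rg /height; ring.
by rewrite !E // lerD2l lerN2 ler_pM2r ?mid_left.
Qed.

Lemma lft_crosses s : crosses s (lft s).
Proof. by rewrite /crosses leqnn /=. Qed.

Lemma rgt_crosses s i : rgt s = i.+1 -> crosses s i.
Proof. by rewrite /crosses => E; have := lft_rgt s; rewrite E ltnS leqnn andbT. Qed.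

Lemma crosses_lft g i : crosses g i -> passes g i \/ lft g = i.
Proof.
by case/andP; rewrite leq_eqVlt => /predU1P[->|l] r; [right|left; apply/andP].
Qed.

Lemma crosses_rgt g i : crosses g i -> passes g i.+1 \/ rgt g = i.+1.
Proof.
case/andP => l; rewrite leq_eqVlt => /predU1P[->|r]; [by right|left].
by apply/andP; split.
Qed.

Lemma passes_below_right g s i : lft s = i -> passes g i -> crosses g i ->
  (h g i < h s i) = (height g (X i) < Y i).
Proof.
move=> ls pg cg; have cs : crosses s i by rewrite -ls lft_crosses.
have xr := Xi_strip (crosses_np cs).
have hs : height s (X i) = Y i by rewrite -ls height_lft.
apply/idP/idP => [lt|]; last by rewrite -hs; apply: edge_to_strip.
by rewrite lt_neqAle passing_off_point // -hs (strip_to_edge cg cs).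
Qed.

Lemma passes_below_left g s i : rgt s = i.+1 -> passes g i.+1 ->
  (h g i < h s i) = (height g (X i.+1) < Y i.+1).
Proof.
move=> rs pg; have cs := rgt_crosses rs; have [cg _] := passes_crosses pg.
have xl := XSi_strip (crosses_np cs).
have hs : height s (X i.+1) = Y i.+1 by rewrite -rs height_rgt.
apply/idP/idP => [lt|]; last by rewrite -hs; apply: edge_to_strip.
by rewrite lt_neqAle passing_off_point // -hs (strip_to_edge cg cs).
Qed.

Lemma passes_crosses0 g i : passes g i -> crosses g i.
Proof. by case/andP => l r; apply/andP; split=> //; exact: ltnW. Qed.

Lemma below_lowest_right s i : lft s = i ->
  (forall g, lft g = i -> h s i <= h g i) -> below s i = under i.
Proof.
move=> ls low; apply: top_eq => g /=; apply/andP/andP => [[cg lt]|[pg lt]].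
  have [pg|lg] := crosses_lft cg; first by rewrite -(passes_below_right ls).
  by move: lt; rewrite ltNge low.
have cg := passes_crosses0 pg.
by rewrite (passes_below_right ls).
Qed.

Lemma under_left i :
  top [pred g | passes g i.+1 & height g (X i.+1) < Y i.+1] i = under i.+1.
Proof. by apply: top_pass => g /andP[]. Qed.

Lemma below_lowest_left s i : rgt s = i.+1 ->
  (forall g, rgt g = i.+1 -> h s i <= h g i) -> below s i = under i.+1.
Proof.
move=> rs low; rewrite -under_left; apply: top_eq => g /=.
apply/andP/andP => [[cg lt]|[pg lt]].
  have [pg|rg] := crosses_rgt cg; first by rewrite -(passes_below_left rs).
  by move: lt; rewrite ltNge low.
have [cg _] := passes_crosses pg.
by rewrite (passes_below_left rs).
Qed.

Lemma left_link_under i : (forall g, rgt g != i) -> left_link i = under i.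
Proof.
move=> none; case: i none => [|i] none.
  by rewrite /left_link /under !top_none // => g.
rewrite -under_left; apply: top_eq => g /=.
rewrite (leq_eqVlt i.+1) (eq_sym i.+1) (negPf (none g)) /=.
rewrite -/(passes g i.+1); have [pg|//] := boolP (passes g i.+1).
by rewrite le_eqVlt (negPf (passing_off_point pg)).
Qed.

Lemma right_link_under i : (forall g, lft g != i) -> right_link i = under i.
Proof.
move=> none; apply: top_eq => g /=; rewrite leq_eqVlt (negPf (none g)) /=.
rewrite -/(passes g i); have [pg|//] := boolP (passes g i).
by rewrite le_eqVlt (negPf (passing_off_point pg)).
Qed.

Lemma left_link_top s i : rgt s = i.+1 ->
  (forall g, rgt g = i.+1 -> h g i <= h s i) -> left_link i.+1 = Some s.
Proof.
move=> rs max; apply: top_unique => [g /andP[cg _]||g /=]; first exact: cg.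
  by rewrite /= -rs height_rgt lexx leqnn lft_rgt.
case/andP => cg hg; have [pg|/max//] := crosses_rgt cg.
by rewrite ltW // (passes_below_left rs) // lt_neqAle passing_off_point.
Qed.

Lemma right_link_top s i : lft s = i ->
  (forall g, lft g = i -> h g i <= h s i) -> right_link i = Some s.
Proof.
move=> ls max; apply: top_unique => [g /andP[cg _]||g /=]; first exact: cg.
  by rewrite /= -ls height_lft lexx leqnn lft_rgt.
case/andP => cg hg; have [pg|/max//] := crosses_lft cg.
by rewrite ltW // (passes_below_right ls) // lt_neqAle passing_off_point.
Qed.

Lemma below_next_right s s' i : lft s = i -> lft s' = i -> h s' i < h s i ->
  (forall g, lft g = i -> h s i <= h g i \/ h g i <= h s' i) ->
  below s i = Some s'.
Proof.
move=> ls ls' lt next; apply: top_unique => [g /andP[]//||g /= /andP[cg lg]].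
  by rewrite /= -{1}ls' lft_crosses lt.
have [pg|/next[|//]] := crosses_lft cg; last by rewrite leNgt lg.
by rewrite ltW // (passes_below_right ls') // -(passes_below_right ls).
Qed.

Lemma below_next_left s s' i : rgt s = i.+1 -> rgt s' = i.+1 -> h s' i < h s i ->
  (forall g, rgt g = i.+1 -> h s i <= h g i \/ h g i <= h s' i) ->
  below s i = Some s'.
Proof.
move=> rs rs' lt next; apply: top_unique => [g /andP[]//||g /= /andP[cg lg]].
  by rewrite /= (rgt_crosses rs') lt.
have [pg|/next[|//]] := crosses_rgt cg; last by rewrite leNgt lg.
by rewrite ltW // (passes_below_left rs') // -(passes_below_left rs).
Qed.

Definition origin (q : S * bool) : nat := if q.2 then lft q.1 else rgt q.1.
Definition flip (q : S * bool) : S * bool := (q.1, ~~ q.2).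
(** Clockwise from straight up: sides to the right, with decreasing slope, then
    sides to the left, with decreasing slope. *)
Definition clockwise : rel (S * bool) := fun q q' =>
  (q.2 && ~~ q'.2) || ((q.2 == q'.2) && (slope q'.1 <= slope q.1)).
Definition star (i : nat) : seq (S * bool) :=
  sort clockwise (enum [pred q | origin q == i]).
Definition rotate (q : S * bool) : S * bool := next (star (origin q)) q.

Lemma clockwise_total : total clockwise.
Proof.
by move=> [s []] [s' []]; rewrite /clockwise //= le_total.
Qed.

Lemma clockwise_trans : transitive clockwise.
Proof.
move=> [s []] [s' []] [s'' []]; rewrite /clockwise //= => a b; exact: le_trans b a.
Qed.

Lemma mem_star q i : (q \in star i) = (origin q == i).
Proof. by rewrite mem_sort mem_enum. Qed.

Lemma star_uniq i : uniq (star i).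
Proof. by rewrite sort_uniq enum_uniq. Qed.

Lemma star_sorted i : sorted clockwise (star i).
Proof. exact: sort_sorted clockwise_total _. Qed.

Lemma rotate_origin q : origin (rotate q) = origin q.
Proof. by apply/eqP; rewrite -mem_star mem_next mem_star. Qed.

Lemma rotate_inj : injective rotate.
Proof.
move=> q q' E; have Eo : origin q = origin q' by rewrite -rotate_origin E rotate_origin.
by move: E; rewrite /rotate Eo => /(can_inj (prev_next (star_uniq _))).
Qed.

Lemma rotate_transitive q q' : origin q = origin q' -> fconnect rotate q q'.
Proof.
move=> E; have cyc : fcycle rotate (star (origin q)).
  apply: (@sub_in_cycle _ (mem (star (origin q))) (frel (next (star (origin q)))))
    (cycle_next (star_uniq _)); last exact/allP.
  by move=> x y /=; rewrite mem_star /rotate => /eqP ->.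
by rewrite (fconnect_cycle cyc) mem_star ?E.
Qed.

Section Classes.
Variable cls : option S -> option S.
Hypothesis cls_link : forall i, (i < np)%N -> cls (left_link i) = cls (right_link i).

(** The class of the region to the left of a dart: above a side traversed
    rightwards, below a side traversed leftwards.  In the latter case the strip
    next to the left end of the side is chosen; by [below_class] the choice does
    not matter. *)
Definition dart_class (q : S * bool) : option S :=
  if q.2 then cls (Some q.1) else cls (below q.1 (lft q.1)).

Lemma below_class s i : crosses s i -> cls (below s i) = cls (below s (lft s)).
Proof.
elim: i => [|i IHi] cs.
  by have /andP[] := cs; rewrite leqn0 => /eqP ->.
have [ps|->//] := crosses_lft cs; have [ci _] := passes_crosses ps.
rewrite -(IHi ci); have [->//|[-> ->]] := below_pass ps.
by rewrite cls_link // (leq_trans (crosses_np ci)) // ltnW.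
Qed.

Lemma dart_class_left s i : rgt s = i.+1 -> dart_class (s, false) = cls (below s i).
Proof. by move=> rs; rewrite /dart_class /= -(below_class (rgt_crosses rs)). Qed.

(** The two darts bound the same sector at their common point.  If the sector
    contains no vertical direction, a single strip shows both of its sides; if
    it contains the downward direction, both darts see the region under the
    point; if it contains the upward direction, they see the two linked
    regions. *)
Lemma dart_class_rotate q : dart_class (rotate q) = dart_class (flip q).
Proof.
have := @next_in_sorted _ _ clockwise_trans _ _ (star_uniq _) (star_sorted _)
  (etrans (mem_star q (origin q)) (eqxx _)).
rewrite -/(rotate q); have := rotate_origin q.
case: (rotate q) => s' d'; case: q => s d /=.
have rs0 : exists i, rgt s = i.+1.
  by case: (rgt s) (lft_rgt s) => // i _; exists i.
case: d d' => [] [] Eo; rewrite /origin /= in Eo.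
- case=> [[ss [le between]]|all].
    have ssn : s' != s by apply: contra ss => /eqP ->.
    rewrite /dart_class /=; congr cls; apply/esym.
    move: le; rewrite /clockwise /= => le.
    apply: below_next_right => //.
      have hl : h s' (lft s) != h s (lft s).
        by apply: crossing_distinct ssn _ (lft_crosses s); rewrite -Eo lft_crosses.
      by rewrite lt_neqAle hl ?right_heights // -1?Eo.
    move=> g lg; have [->|gs] := eqVneq g s; first by left.
    have [->|gs'] := eqVneq g s'; first by right.
    have := between (g, true); rewrite mem_star /origin /= lg eqxx => /(_ isT).
    rewrite /clockwise !xpair_eqE !andbT /= => /(_ gs gs').
    by case=> ?; [left|right]; rewrite right_heights.
  have maxs g : rgt g != lft s.
    apply/negP => /eqP rg; have := all (g, false).
    rewrite mem_star /origin /= rg eqxx => /(_ isT) [].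
    by rewrite xpair_eqE andbF => /(_ isT).
  have lows g : lft g = lft s -> h s (lft s) <= h g (lft s).
    move=> lg; rewrite right_heights //.
    have [->//|gs] := eqVneq g s; have := all (g, true).
    rewrite mem_star /origin /= lg eqxx => /(_ isT) [] /=.
    by rewrite xpair_eqE (negPf gs) /= => /(_ isT).
  have tops g : lft g = lft s -> h g (lft s) <= h s' (lft s).
    move=> lg; rewrite right_heights //.
    have [->//|gs] := eqVneq g s'; have := all (g, true).
    rewrite mem_star /origin /= lg eqxx => /(_ isT) [_] /=.
    by rewrite xpair_eqE (negPf gs) /= => /(_ isT).
  rewrite /dart_class /= (below_lowest_right erefl lows).
  rewrite -(left_link_under maxs) cls_link ?(ltn_trans (lft_rgt s)) //.
  by rewrite (right_link_top Eo).
- case=> [[_ [_ between]]|all].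
    have [i ri] : exists i, rgt s' = i.+1.
      by case: (rgt s') (lft_rgt s') => // i _; exists i.
    rewrite (dart_class_left ri) /dart_class /=.
    rewrite (@below_lowest_right s (lft s) erefl); last first.
      move=> g lg; rewrite right_heights //.
      have [->//|gs] := eqVneq g s; have := between (g, true).
      rewrite mem_star /origin /= lg eqxx => /(_ isT).
      by rewrite /clockwise !xpair_eqE /= (negPf gs) andbF => /(_ isT isT) [].
    rewrite (below_lowest_left ri) -?Eo ?ri // => g rg; rewrite left_heights //.
    have [->//|gs] := eqVneq g s'; have := between (g, false).
    rewrite mem_star /origin /= rg -Eo ri eqxx => /(_ isT).
    by rewrite /clockwise !xpair_eqE /= (negPf gs) andbF => /(_ isT isT) [].
  have := all (s, true); rewrite mem_star eqxx => /(_ isT) [_] /=.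
  by rewrite xpair_eqE andbF => /(_ isT).
- have [i ri] := rs0.
  case=> [[_ [le _]]|all]; first by rewrite /clockwise in le.
  rewrite /dart_class /= -(@left_link_top s i ri); last first.
    move=> g rg; rewrite left_heights //.
    have [->//|gs] := eqVneq g s; have := all (g, false).
    rewrite mem_star /origin /= rg ri eqxx => /(_ isT) [] /=.
    by rewrite xpair_eqE (negPf gs) /= => /(_ isT).
  rewrite cls_link -1?ri //; rewrite ri -(@right_link_top s' i.+1) -?ri // => g lg.
  rewrite right_heights ?Eo //.
  have [->//|gs] := eqVneq g s'; have := all (g, true).
  rewrite mem_star /origin /= lg eqxx => /(_ isT) [_] /=.
  by rewrite xpair_eqE (negPf gs) /= => /(_ isT).
have [i ri] := rs0; have ri' : rgt s' = i.+1 by rewrite Eo.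
rewrite (dart_class_left ri').
case=> [[ss [le between]]|all].
  have ssn : s' != s by apply: contra ss => /eqP ->.
  rewrite /dart_class /=; congr cls.
  apply: below_next_left => //.
    have hd : h s i != h s' i by rewrite crossing_distinct ?rgt_crosses // eq_sym.
    by rewrite lt_neqAle hd left_heights.
  move=> g rg; have [->|gs] := eqVneq g s; first by right.
  have [->|gs'] := eqVneq g s'; first by left.
  have := between (g, false); rewrite mem_star /origin /= rg ri eqxx => /(_ isT).
  rewrite /clockwise !xpair_eqE !andbT /= => /(_ gs gs').
  by case=> ?; [right|left]; rewrite left_heights.
rewrite /dart_class /= -(@left_link_top s i ri); last first.
  move=> g rg; rewrite left_heights //.
  have [->//|gs] := eqVneq g s; have := all (g, false).
  rewrite mem_star /origin /= rg ri eqxx => /(_ isT) [] /=.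
  by rewrite xpair_eqE (negPf gs) /= => /(_ isT).
rewrite cls_link -1?ri //; congr cls; rewrite ri right_link_under => [|g].
  apply: below_lowest_left => // g rg; rewrite left_heights //.
  have [->//|gs] := eqVneq g s'; have := all (g, false).
  rewrite mem_star /origin /= rg ri eqxx => /(_ isT) [_] /=.
  by rewrite xpair_eqE (negPf gs) /= => /(_ isT).
apply/negP => /eqP lg; have := all (g, true).
rewrite mem_star /origin /= lg ri eqxx => /(_ isT) [_] /=.
by rewrite xpair_eqE andbF => /(_ isT).
Qed.

End Classes.

(** There are [#|S| + 1] regions and [np] links.  The bottom region is seen by
    the lowest side at the leftmost point. *)
Lemma strip_classes : (0 < np)%N -> exists cq : S * bool -> option S,
  (forall q, cq (rotate q) = cq (flip q)) /\
  (#|S| + 1 <= np + #|[set cq q | q : S * bool]|)%N.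
Proof.
move=> np0.
have [cls cls_eq cls_card] :=
  merge_classes [seq (left_link i, right_link i) | i <- iota 0 np].
have cls_link i : (i < np)%N -> cls (left_link i) = cls (right_link i).
  by move=> ni; apply: (cls_eq (_, _)); apply/mapP; exists i; rewrite ?mem_iota.
exists (dart_class cls); split; first exact: dart_class_rotate.
move: cls_card; rewrite card_option size_map size_iota addn1 => /leq_trans; apply.
rewrite leq_add2l; apply/subset_leq_card/subsetP => _ /imsetP[[s|] _ ->].
  by apply/imsetP; exists (s, true).
have [s0 ls0] : exists s, lft s == 0%N.
  have [s [<-|rs]] := no_isolated np0; first by exists s.
  by have := lft_rgt s; rewrite rs.
have [s /eqP ls low] := @Order.TotalTheory.arg_minP _ _ _ s0
  (fun s => lft s == 0%N) (fun s => h s 0) ls0.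
apply/imsetP; exists (s, false) => //; rewrite /dart_class /= ls.
rewrite (below_lowest_right ls) => [|g /eqP lg]; last exact: low.
by rewrite /under top_none // => g.
Qed.

End Strips.

(** * The combinatorial map of a polygonal drawing *)

Section Shear.
Local Open Scope ring_scope.

(** Each pair of points excludes at most one shear, and there are finitely many
    pairs. *)
Lemma generic_shear (R : realFieldType) (ps : seq (R * R)) :
  exists eps : R, {in ps &, injective (fun p => p.1 + eps * p.2)}.
Proof.
pose bad := [seq (q.1 - p.1) / (p.2 - q.2) | p <- ps, q <- ps].
have le_bad b : b \in bad -> b <= \sum_(x <- bad) `|x|.
  elim: bad => // x l IH; rewrite inE big_cons => /predU1P[->|/IH le].
    by rewrite (le_trans (ler_norm x)) // lerDl sumr_ge0.
  by rewrite (le_trans le) // lerDr.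
exists (1 + \sum_(x <- bad) `|x|) => p q pP qP /=; set eps := 1 + _ => E.
have [E2|ne2] := eqVneq p.2 q.2.
  move: E; rewrite E2 => /addIr E1.
  by rewrite (surjective_pairing p) E1 E2 -surjective_pairing.
have d0 : p.2 - q.2 != 0 by rewrite subr_eq0.
have Ee : eps = (q.1 - p.1) / (p.2 - q.2).
  by apply: (canRL (mulfK d0)); lra.
have /le_bad : eps \in bad by rewrite Ee; apply: allpairs_f.
by rewrite /eps gerDr ler10.
Qed.

End Shear.

Section Drawing.
Local Open Scope ring_scope.
Variables (R : realType) (V : finType) (e : rel V).
Variables (pos : V -> R * R) (arc : V -> V -> seq (R * R)).
Hypotheses (he : simple_graph e) (hd : plane_drawing e pos arc).

Definition dart : finType := {p : V * V | e p.1 p.2}.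
Implicit Types d : dart.

Definition source d : V := (val d).1.
Definition target d : V := (val d).2.

Lemma dart_edge d : e (source d) (target d).
Proof. exact: valP d. Qed.

Lemma opposite_subproof d : e (val d).2 (val d).1.
Proof. by case: he => sym _; rewrite sym; exact: valP d. Qed.

Definition opposite d : dart :=
  Sub ((val d).2, (val d).1) (opposite_subproof d).

Lemma oppositeK : involutive opposite.
Proof. by move=> d; apply: val_inj => /=; rewrite -surjective_pairing. Qed.

Lemma dart_eq d d' : source d = source d' -> target d = target d' -> d = d'.
Proof.
move=> s t; apply: val_inj; rewrite (surjective_pairing (val d)).
by rewrite (surjective_pairing (val d')); congr (_, _).
Qed.

Lemma source_neq_target d : source d != target d.
Proof.
by apply: contraTneq (dart_edge d) => ->; case: he => _ ->.
Qed.

Definition nsides d : nat := (size (arc (source d) (target d))).-1.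
Definition corner d (i : nat) : R * R := nth 0 (arc (source d) (target d)) i.

Let arc_simple d : simple_polyline (arc (source d) (target d)).
Proof. by have [] := drawing_arc hd (dart_edge d). Qed.

Lemma size_arc d : size (arc (source d) (target d)) = (nsides d).+1.
Proof. by rewrite prednK //; have [s _ _] := arc_simple d; apply: ltnW. Qed.

Lemma nsides_gt0 d : (0 < nsides d)%N.
Proof. by have [s _ _] := arc_simple d; rewrite -ltnS -size_arc. Qed.

Lemma corner_first d : corner d 0 = pos (source d).
Proof. by have [_ h _ _] := drawing_arc hd (dart_edge d); rewrite /corner nth0. Qed.

Lemma corner_last d : corner d (nsides d) = pos (target d).
Proof.
by have [_ _ h _] := drawing_arc hd (dart_edge d); rewrite /corner nth_last.
Qed.

Lemma nsides_opposite d : nsides (opposite d) = nsides d.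
Proof.
have [_ _ _ h] := drawing_arc hd (dart_edge d).
by rewrite /nsides /= -[arc _ _]/(arc (target d) (source d)) h size_rev.
Qed.

Lemma corner_opposite d i : (i <= nsides d)%N ->
  corner (opposite d) i = corner d (nsides d - i).
Proof.
move=> le; have [_ _ _ h] := drawing_arc hd (dart_edge d).
rewrite /corner -[arc (source _) _]/(arc (target d) (source d)) h.
by rewrite nth_rev size_arc ?ltnS // subSS.
Qed.

Definition on_dart_side d (i : nat) (p : R * R) : Prop :=
  on_side (arc (source d) (target d)) i p.

Lemma on_dart_sideP d i p : (i < nsides d)%N ->
  on_segment (corner d i) (corner d i.+1) p -> on_dart_side d i p.
Proof. by move=> lt seg; split; rewrite // size_arc. Qed.

Lemma on_segment_left (a b : R * R) : on_segment a b a.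
Proof.
exists 0; first by rewrite lexx ler01.
by rewrite !mul0r !addr0 -surjective_pairing.
Qed.

Lemma on_segment_right (a b : R * R) : on_segment a b b.
Proof.
exists 1; first by rewrite lexx ler01.
by rewrite {1}(surjective_pairing b); congr (_, _); ring.
Qed.

Lemma on_segment_sym (a b p : R * R) : on_segment a b p -> on_segment b a p.
Proof.
case=> t /andP[t0 t1] ->; exists (1 - t); first by apply/andP; split; lra.
by congr (_, _); ring.
Qed.

Lemma sides_meet d i j p : (i < j)%N -> on_dart_side d i p -> on_dart_side d j p ->
  j = i.+1 /\ p = corner d j.
Proof. by have [_ _ h] := arc_simple d; apply: h. Qed.

Lemma corner_step d i : (i < nsides d)%N -> corner d i != corner d i.+1.
Proof. by move=> lt; have [_ h _] := arc_simple d; apply: h; rewrite size_arc. Qed.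

Lemma corner_inj d i j : (i <= nsides d)%N -> (j <= nsides d)%N ->
  corner d i = corner d j -> i = j.
Proof.
wlog ij : i j / (i < j)%N.
  by move=> h ni nj E; case: (ltngtP i j) => // lt; [apply: h|apply/esym/h].
move=> _ nj E; have ni : (i < nsides d)%N := leq_trans ij nj.
have si : on_dart_side d i (corner d i) by apply/on_dart_sideP/on_segment_left.
have [jn|jn] := ltnP j (nsides d).
  have sj : on_dart_side d j (corner d i).
    by rewrite E; apply/on_dart_sideP/on_segment_left.
  have [Ej _] := sides_meet ij si sj.
  by have := corner_step ni; rewrite E Ej eqxx.
case: j ij nj E jn => // j; rewrite ltnS leq_eqVlt => /predU1P[->|ij] nj E jn.
  by have := corner_step nj; rewrite E eqxx.
have sj : on_dart_side d j (corner d i).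
  by rewrite E; apply/on_dart_sideP/on_segment_right.
have [Ej Ec] := sides_meet ij si sj.
by have := corner_step ni; rewrite Ec Ej eqxx.
Qed.

Lemma dart_side_at_source d i : on_dart_side d i (corner d 0) -> i = 0%N.
Proof.
case: i => // i si; have s0 : on_dart_side d 0 (corner d 0).
  by apply/on_dart_sideP/on_segment_left/nsides_gt0.
have [[Ei] Ec] := sides_meet (ltn0Sn i) s0 si.
by have := corner_step (nsides_gt0 d); rewrite {1}Ec Ei eqxx.
Qed.

Lemma dart_side_at_target d i :
  on_dart_side d i (corner d (nsides d)) -> i.+1 = nsides d.
Proof.
move=> si; have [ni _] := si; rewrite size_arc ltnS in ni.
move: ni; rewrite leq_eqVlt => /predU1P[//|ni].
case En : (nsides d) ni => [//|n] ni.
have sn : on_dart_side d n (corner d (nsides d)).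
  by rewrite En; apply: on_dart_sideP; rewrite ?En //; apply: on_segment_right.
have [_ Ec] := sides_meet (ni : (i < n)%N) si sn.
have := corner_inj (leqnn _) (_ : (n <= nsides d)%N) Ec.
by rewrite En leqnSn => /(_ isT) /esym /n_Sn.
Qed.

Lemma corner_on_dart d i : (i <= nsides d)%N ->
  on_polyline (arc (source d) (target d)) (corner d i).
Proof.
rewrite leq_eqVlt => /predU1P[->|lt].
  exists (nsides d).-1; split; first by rewrite size_arc (prednK (nsides_gt0 d)).
  by rewrite (prednK (nsides_gt0 d)); apply: on_segment_right.
by exists i; apply/on_dart_sideP/on_segment_left.
Qed.

Lemma corner_is_pos d i v : (i <= nsides d)%N -> corner d i = pos v ->
  i = 0%N /\ v = source d \/ i = nsides d /\ v = target d.
Proof.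
move=> le E; have [/eqP Es|ns] := boolP (corner d i == pos (source d)).
  left; split; last by apply: (drawing_inj hd); rewrite -E Es.
  by apply: (@corner_inj d) => //; rewrite Es corner_first.
have [/eqP Et|nt] := boolP (corner d i == pos (target d)).
  right; split; last by apply: (drawing_inj hd); rewrite -E Et.
  by apply: (@corner_inj d) => //; rewrite Et corner_last.
have := drawing_vertex hd v (dart_edge d) (corner_on_dart le) ns nt.
by rewrite E eqxx.
Qed.

Lemma same_edge d d' : [set source d; target d] = [set source d'; target d'] ->
  d' = d \/ d' = opposite d.
Proof.
move=> E; have st := source_neq_target d; have st' := source_neq_target d'.
have : source d' \in [set source d; target d] by rewrite E set21.
have : target d' \in [set source d; target d] by rewrite E set22.
rewrite !inE => /orP[]/eqP Et /orP[]/eqP Es.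
- by rewrite Es Et eqxx in st'.
- by right; apply: dart_eq.
- by left; apply: dart_eq.
by rewrite Es Et eqxx in st'.
Qed.

Lemma darts_meet d d' i j p : d' != d -> d' != opposite d ->
  on_dart_side d i p -> on_dart_side d' j p ->
  p = corner d i \/ p = corner d i.+1.
Proof.
move=> dd dd' si sj.
have ne : [set source d; target d] != [set source d'; target d'].
  by apply/eqP => /same_edge[] E; [rewrite E eqxx in dd|rewrite E eqxx in dd'].
have [/eqP Es|ns] := boolP (p == pos (source d)).
  rewrite Es -corner_first in si *; left.
  by rewrite (dart_side_at_source si).
have [/eqP Et|nt] := boolP (p == pos (target d)).
  rewrite Et -corner_last in si *; right.
  by rewrite (dart_side_at_target si).
have [] := drawing_cross hd (dart_edge d) (dart_edge d') ne _ ns nt.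
  by exists i.
by exists j.
Qed.

Definition side : finType := {d : dart & 'I_(nsides d)}.
Implicit Types q : side.

Definition mkside d i (h : (i < nsides d)%N) : side := Tagged _ (Ordinal h).

Lemma side_eq q q' : tag q = tag q' -> tagged q = tagged q' :> nat -> q = q'.
Proof.
case: q => d i; case: q' => d' i' /= E; case: d' / E i' => i' E.
by congr existT; apply: val_inj.
Qed.

Definition src q : R * R := corner (tag q) (tagged q).
Definition tgt q : R * R := corner (tag q) (tagged q).+1.

Lemma reverse_subproof q :
  (nsides (tag q) - (tagged q).+1 < nsides (opposite (tag q)))%N.
Proof.
by case: q => d i /=; rewrite nsides_opposite ltn_subrL nsides_gt0.
Qed.

Definition reverse q : side := mkside (reverse_subproof q).

Lemma reverseK : involutive reverse.
Proof.
case=> d i; apply: side_eq; rewrite /= ?oppositeK // nsides_opposite.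
move: (nat_of_ord i) (ltn_ord i) => m.
by move: (nsides d) => n; clear; lia.
Qed.

Lemma src_reverse q : src (reverse q) = tgt q.
Proof.
case: q => d i; rewrite /src /tgt /= corner_opposite ?leq_subr //.
by rewrite subKn.
Qed.

Lemma tgt_reverse q : tgt (reverse q) = src q.
Proof. by rewrite -src_reverse reverseK. Qed.

Lemma src_neq_tgt q : src q != tgt q.
Proof. by case: q => d i; apply: corner_step. Qed.

Lemma side_on_dart q p : on_segment (src q) (tgt q) p ->
  on_dart_side (tag q) (tagged q) p.
Proof. by case: q => d i; apply: on_dart_sideP. Qed.

Lemma sides_cross_at_end q q' p : q' != q -> q' != reverse q ->
  on_segment (src q) (tgt q) p -> on_segment (src q') (tgt q') p ->
  p = src q \/ p = tgt q.
Proof.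
(* Replacing [q'] by its reverse, both sides run along the same orientation of
   their arc when they belong to the same one. *)
wlog nopp : q' / tag q' != opposite (tag q).
  move=> h qq qq' s s'; have [Et|] := eqVneq (tag q') (opposite (tag q)); last first.
    by move=> nopp; apply: (h q').
  apply: (h (reverse q')) => //.
  - rewrite /= Et oppositeK; apply/eqP => E.
    have := source_neq_target (tag q); rewrite {1}E /source /target /=.
    by rewrite -/(source _) eqxx.
  - by rewrite -(inj_eq (inv_inj reverseK)) reverseK.
  - by rewrite (inj_eq (inv_inj reverseK)).
  by rewrite src_reverse tgt_reverse; apply: on_segment_sym.
move=> qq _ s s'; have [Et|nt] := eqVneq (tag q') (tag q); last first.
  exact: darts_meet nt nopp (side_on_dart s) (side_on_dart s').
have ne : tagged q != tagged q' :> nat.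
  by apply: contra_neq qq => E; apply: side_eq.
have si := side_on_dart s; move: (side_on_dart s').
move: (nat_of_ord (tagged q')) ne => j ne; rewrite Et => sj.
have [lt|lt|/eqP] := ltngtP (tagged q) j; last by rewrite (negPf ne).
  by have [Ej ->] := sides_meet lt si sj; right; rewrite /tgt Ej.
by have [_ ->] := sides_meet lt sj si; left.
Qed.

Lemma sides_at_pos q v : src q = pos v -> tagged q = 0%N :> nat /\ source (tag q) = v.
Proof.
case: q => d i; rewrite /src /= => E.
have [[-> ->]//|[Ei _]] := corner_is_pos (ltnW (ltn_ord i)) E.
by have := ltn_ord i; rewrite Ei ltnn.
Qed.

(** At an inner corner of an arc there are only the two sides of that arc. *)
Lemma sides_at_corner q q' : (0 < tagged q)%N -> src q' = src q ->
  q' = q \/ [/\ tag q' = opposite (tag q) &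
               tagged q' = (nsides (tag q) - tagged q)%N :> nat].
Proof.
case: q => d i; case: q' => d' j /= i0 E.
have [ni nj] := (ltn_ord i, ltn_ord j).
have not_pos v : corner d i <> pos v.
  move=> /(corner_is_pos (ltnW ni)) [[Ei _]|[Ei _]]; first by rewrite Ei in i0.
  by rewrite Ei ltnn in ni.
have [Ed|nd] := eqVneq d' d.
  left; apply: side_eq => //=; move: E nj; rewrite /src /=.
  move: (nat_of_ord j) => {}j; rewrite Ed => E nj.
  by apply: (@corner_inj d) E; apply: ltnW.
have [Ed|nd'] := eqVneq d' (opposite d).
  right; split=> //=; move: E nj; rewrite /src /=.
  move: (nat_of_ord j) => {}j; rewrite Ed nsides_opposite => E nj.
  rewrite corner_opposite 1?ltnW // in E.
  have := corner_inj (leq_subr _ _) (ltnW ni) E; move: ni nj; clear.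
  by move: (nsides d) (nat_of_ord i) => n a; lia.
have si : on_dart_side d i (corner d i) by apply/on_dart_sideP/on_segment_left.
have sj : on_dart_side d' j (corner d i).
  by rewrite -[corner d i]E; apply/on_dart_sideP/on_segment_left.
have ne : [set source d; target d] != [set source d'; target d'].
  by apply/eqP => /same_edge[] E'; [rewrite E' eqxx in nd|rewrite E' eqxx in nd'].
have on_d : on_polyline (arc (source d) (target d)) (corner d i) by exists i.
have := drawing_cross hd (dart_edge d) (dart_edge d') ne on_d.
by case; [apply/eqP/not_pos|apply/eqP/not_pos|exists j].
Qed.

(** One orientation of each edge, to count inner corners once. *)
Definition half (d : dart) : bool :=
  (enum_rank (source d) < enum_rank (target d))%N.

Lemma half_opposite d : half (opposite d) = ~~ half d.
Proof.
have ne : enum_rank (source d) != enum_rank (target d) :> nat.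
  by rewrite (inj_eq val_inj) (inj_eq enum_rank_inj) source_neq_target.
by rewrite /half -leqNgt [RHS]leq_eqVlt eq_sym (negPf ne).
Qed.

Definition points : seq (R * R) :=
  [seq pos v | v : V] ++
  flatten [seq [seq corner d i | i <- iota 1 (nsides d).-1] | d <- enum half].

Lemma size_points :
  size points = (#|V| + \sum_(d | half d) (nsides d).-1)%N.
Proof.
rewrite size_cat size_map -cardT size_flatten /shape -map_comp sumnE big_map big_enum /=.
by congr (_ + _)%N; apply: eq_bigr => d _ /=; rewrite size_map size_iota.
Qed.

Lemma src_in_points q : src q \in points.
Proof.
case: q => d i; rewrite /src /= mem_cat; apply/orP.
have [i0|i0] := posnP i.
  by left; rewrite i0 corner_first; apply/mapP; exists (source d); rewrite ?mem_enum.
right; apply/flattenP.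
have inner d' j : half d' -> (0 < j < nsides d')%N -> corner d' j = corner d i ->
    exists2 l, l \in [seq [seq corner d0 i | i <- iota 1 (nsides d0).-1]
                        | d0 <- enum half] & corner d i \in l.
  move=> hd' /andP[j0 jn] E; exists [seq corner d' i | i <- iota 1 (nsides d').-1].
    by apply/mapP; exists d'; rewrite ?mem_enum.
  by rewrite -E; apply: map_f; rewrite mem_iota j0 add1n (ltn_predK jn).
have [hd'|nh] := boolP (half d); first by apply: (inner d i); rewrite ?i0 ?ltn_ord.
apply: (inner (opposite d) (nsides d - i)%N); first by rewrite half_opposite.
  by rewrite nsides_opposite subn_gt0 ltn_ord ltn_subrL i0 nsides_gt0.
by rewrite corner_opposite ?leq_subr // subKn // ltnW.
Qed.

Lemma tgt_in_points q : tgt q \in points.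
Proof. by rewrite -src_reverse src_in_points. Qed.

Hypothesis no_isolated_vertex : forall v, exists u, e v u.

Definition first_side d : side := mkside (nsides_gt0 d).

Lemma point_is_src p : p \in points -> exists q, src q = p.
Proof.
rewrite mem_cat => /orP[/mapP[v _ ->]|/flattenP[_ /mapP[d _ ->] /mapP[i]]].
  have [u evu] := no_isolated_vertex v; pose d : dart := Sub (v, u) evu.
  by exists (first_side d); rewrite /src /= corner_first.
rewrite mem_iota add1n => /andP[_ lt] ->.
have ltn : (i < nsides d)%N by rewrite prednK ?nsides_gt0 // in lt.
by exists (mkside ltn).
Qed.

Lemma card_sides : #|{: side}| = (\sum_d nsides d)%N.
Proof.
by rewrite card_tagged sumnE big_map big_enum; apply: eq_bigr => d _; rewrite card_ord.
Qed.

Lemma sum_half (F : dart -> nat) : (forall d, F (opposite d) = F d) ->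
  (\sum_d F d = (\sum_(d | half d) F d).*2)%N.
Proof.
move=> FE; rewrite -addnn (bigID half) /=; congr (_ + _)%N.
rewrite (reindex_inj (inv_inj oppositeK)) /=.
by apply: eq_big => d; rewrite ?half_opposite ?negbK.
Qed.

(** The regions of [strip_classes], for the sheared drawing. *)
Lemma side_map : (0 < #|V|)%N ->
  exists (K : finType) (rot : side -> side) (cq : side -> K),
  [/\ injective rot, forall q, src (rot q) = src q,
      forall q q', src q = src q' -> fconnect rot q q',
      forall q, cq (rot q) = cq (reverse q) &
      (#|{: side}| + 2 <= (size points).*2 + #|[set cq q | q : side]|.*2)%N].
Proof.
move=> V0; have [eps eps_inj] := generic_shear points.
pose x (p : R * R) := p.1 + eps * p.2.
have x_inj : {in points &, injective x} by [].
pose P := sort (relpre x <=%R) (undup points).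
have memP p : (p \in P) = (p \in points) by rewrite mem_sort mem_undup.
have uP : uniq P by rewrite sort_uniq undup_uniq.
have sortP : sorted (relpre x <=%R) P by apply: sort_sorted => p q; exact: le_total.
pose np := size P.
pose X i := x (nth 0 P i); pose Y i := (nth 0 P i).2.
have np_le : (np <= size points)%N by rewrite /np size_sort size_undup.
have X_incr i j : (i < j)%N -> (j < np)%N -> X i < X j.
  move=> ij nj; have ni := ltn_trans ij nj.
  rewrite lt_neqAle; apply/andP; split.
    apply/eqP => /x_inj E; have := nth_uniq 0 ni nj uP.
    by rewrite E -?memP ?mem_nth // eqxx (ltn_eqF ij).
  have tr : transitive (relpre x <=%R) by move=> a b c; exact: le_trans.
  by apply: (sorted_ltn_nth tr 0 sortP) => //.
pose right q := x (src q) < x (tgt q).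
have x_src_tgt q : x (src q) != x (tgt q).
  by rewrite (inj_in_eq x_inj) ?src_in_points ?tgt_in_points ?src_neq_tgt.
have right_reverse q : right (reverse q) = ~~ right q.
  by rewrite /right src_reverse tgt_reverse -leNgt le_eqVlt eq_sym (negPf (x_src_tgt q)).
pose S : finType := {q : side | right q}.
pose lft (s : S) := index (src (val s)) P.
pose rgt (s : S) := index (tgt (val s)) P.
have srcP q : src q \in P by rewrite memP src_in_points.
have tgtP q : tgt q \in P by rewrite memP tgt_in_points.
have X_lft s : X (lft s) = x (src (val s)) by rewrite /X nth_index.
have X_rgt s : X (rgt s) = x (tgt (val s)) by rewrite /X nth_index.
have Y_lft s : Y (lft s) = (src (val s)).2 by rewrite /Y nth_index.
have Y_rgt s : Y (rgt s) = (tgt (val s)).2 by rewrite /Y nth_index.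
have rgt_np s : (rgt s < np)%N by rewrite index_mem.
have lft_np s : (lft s < np)%N by rewrite index_mem.
have lft_rgt s : (lft s < rgt s)%N.
  have := valP s; rewrite /right /= -X_lft -X_rgt.
  case: ltngtP => // [/X_incr/(_ (lft_np s))|->]; last by rewrite ltxx.
  by move=> lt lt'; have := lt_trans lt lt'; rewrite ltxx.
pose slope (s : S) := ((tgt (val s)).2 - (src (val s)).2)
                      / (x (tgt (val s)) - x (src (val s))).
pose offset s := (src (val s)).2 - slope s * x (src (val s)).
have run_gt0 (s : S) : 0 < x (tgt (val s)) - x (src (val s)).
  by rewrite subr_gt0; exact: valP s.
have height_lft s : height slope offset s (X (lft s)) = Y (lft s).
  by rewrite X_lft Y_lft /height /offset addrC subrK.
have height_rgt s : height slope offset s (X (rgt s)) = Y (rgt s).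
  rewrite X_rgt Y_rgt /height /offset /slope; field.
  exact: lt0r_neq0 (run_gt0 s).
(* The point of the side [s] whose sheared abscissa is [z]. *)
have on_side_height s z : X (lft s) <= z <= X (rgt s) ->
    on_segment (src (val s)) (tgt (val s))
      (z - eps * height slope offset s z, height slope offset s z).
  rewrite X_lft X_rgt => /andP[lz zr].
  have run0 := lt0r_neq0 (run_gt0 s).
  exists ((z - x (src (val s))) / (x (tgt (val s)) - x (src (val s)))).
    apply/andP; split; first by rewrite divr_ge0 ?subr_ge0 ?(ltW (valP s)).
    by rewrite ler_pdivrMr ?run_gt0 // mul1r lerD2r.
  rewrite /height /offset /slope; move: run0; rewrite /x => run0.
  by congr (_, _); field.
have no_crossing s s' z : s != s' -> X (lft s) <= z <= X (rgt s) ->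
    X (lft s') <= z <= X (rgt s') ->
    height slope offset s z = height slope offset s' z ->
    (z = X (lft s) \/ z = X (rgt s)) /\ (z = X (lft s') \/ z = X (rgt s')).
  move=> ss zs zs' E; have seg := on_side_height s z zs.
  have seg' := on_side_height s' z zs'; rewrite -E in seg'.
  have ne : val s' != val s by rewrite eq_sym (inj_eq val_inj).
  have ne' : val s' != reverse (val s).
    apply/eqP => Es; have := valP s'; rewrite Es right_reverse.
    by rewrite (valP s).
  have ne'' : val s != reverse (val s').
    by apply: contra ne' => /eqP ->; rewrite reverseK.
  have neC := ne; rewrite eq_sym in ne.
  have xp : x (z - eps * height slope offset s z, height slope offset s z) = z.
    by rewrite /x /= subrK.
  rewrite !X_lft !X_rgt -xp; split.
    by case: (sides_cross_at_end neC ne' seg seg') => ->; [left|right].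
  by case: (sides_cross_at_end ne ne'' seg' seg) => ->; [left|right].
have no_isolated i : (i < np)%N -> exists s, lft s = i \/ rgt s = i.
  move=> ni; have [q Eq] : exists q, src q = nth 0 P i.
    by apply: point_is_src; rewrite -memP mem_nth.
  have Ei : index (src q) P = i by rewrite Eq index_uniq.
  have [rq|nrq] := boolP (right q).
    by exists (Sub q rq); left.
  have rq : right (reverse q) by rewrite right_reverse.
  by exists (Sub (reverse q) rq); right; rewrite /rgt /= tgt_reverse.
have np0 : (0 < np)%N.
  have /card_gt0P[v _] := V0; have [u evu] := no_isolated_vertex v.
  have := srcP (first_side (Sub (v, u) evu : dart)).
  by rewrite -index_mem; apply: leq_trans.
have [cq [cqE cq_card]] := strip_classes lft_rgt rgt_np X_incr height_lft height_rgt
  no_crossing no_isolated np0.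
pose rt := rotate slope lft rgt.
pose und (a : S * bool) : side := if a.2 then val a.1 else reverse (val a.1).
have rS (s : S) : right (sval s) := valP s.
have und_inj : injective und.
  move=> [s b] [s' b']; rewrite /und /=; case: b; case: b'.
  - by move=> /val_inj ->.
  - by move=> E; have := rS s; rewrite E right_reverse rS.
  - by move=> E; have := rS s'; rewrite -E right_reverse rS.
  by move=> /(inv_inj reverseK)/val_inj ->.
have und_onto q : exists a, und a = q.
  have [rq|nrq] := boolP (right q); first by exists (Sub q rq, true).
  have rq : right (reverse q) by rewrite right_reverse.
  by exists (Sub (reverse q) rq, false); rewrite /und /= reverseK.
have card_S : #|{: side}| = #|S|.*2.
  have <- : #|{: S * bool}| = #|S|.*2 by rewrite card_prod card_bool muln2.
  rewrite -(card_imset _ und_inj); apply: eq_card => q.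
  by have [a <-] := und_onto q; rewrite !inE imset_f.
have [dir dirK] : exists dir, cancel dir und.
  have [dir dirE] := fin_all_exists und_onto.
  by exists dir.
have undK : cancel und dir by move=> a; apply: und_inj; rewrite dirK.
have src_und a : index (src (und a)) P = origin lft rgt a.
  by case: a => s []; rewrite /und /origin /= ?src_reverse.
have src_eq a a' : origin lft rgt a = origin lft rgt a' -> src (und a) = src (und a').
  rewrite -!src_und => E.
  by rewrite -(nth_index 0 (srcP (und a))) E nth_index.
exists (option S), (fun q => und (rt (dir q))), (cq \o dir); split.
- by move=> q q' /und_inj /(@rotate_inj _ _ slope lft rgt) E; rewrite -(dirK q) E dirK.
- by move=> q; rewrite -{2}(dirK q); apply: src_eq; apply: rotate_origin.
- move=> q q' E; have Eo : origin lft rgt (dir q) = origin lft rgt (dir q').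
    by rewrite -!src_und !dirK E.
  have /iter_findex E2 := rotate_transitive slope Eo.
  have iter_und m a : und (iter m rt a) = iter m (fun q => und (rt (dir q))) (und a).
    by elim: m => //= m <-; rewrite undK.
  by rewrite -(dirK q') -E2 iter_und dirK; exact: fconnect_iter.
- move=> q /=; rewrite undK cqE; congr cq.
  rewrite -{2}(dirK q); case: (dir q) => s b; apply: und_inj; rewrite dirK /und /=.
  by case: b; rewrite ?reverseK.
rewrite card_S -[X in (_ + X)%N]/(1.*2)%N -!doubleD leq_double.
apply: leq_trans cq_card _; apply: leq_add np_le _.
apply/subset_leq_card/subsetP => _ /imsetP[a _ ->].
by apply/imsetP; exists (und a); rewrite //= undK.
Qed.

Lemma first_side_inj : injective first_side.
Proof. by move=> d d' /(congr1 (@tag _ _)). Qed.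

Lemma src_first_side d : src (first_side d) = pos (source d).
Proof. exact: corner_first. Qed.

Lemma side_eq_first q v : src q = pos v -> q = first_side (tag q).
Proof. by case/sides_at_pos => E _; apply: side_eq. Qed.

Section Transport.
Variables (K : finType) (rot : side -> side) (cq : side -> K).
Hypotheses (rot_inj : injective rot) (rot_src : forall q, src (rot q) = src q).
Hypothesis rot_trans : forall q q', src q = src q' -> fconnect rot q q'.
Hypothesis cq_rot : forall q, cq (rot q) = cq (reverse q).

(** Only two sides meet at an inner corner, and the rotation exchanges them. *)
Lemma rot_inner_corner d i (h : (i < nsides d)%N) (h' : (i.+1 < nsides d)%N) :
  rot (reverse (mkside h)) = mkside h'.
Proof.
set q := reverse _; set r := mkside h'.
have Eqr : src q = src r by rewrite src_reverse.
have [->//|[Et Ei]] := @sides_at_corner r (rot q) isT (etrans (rot_src q) Eqr).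
(* If [rot] fixed [q], it could not reach [r]. *)
have fixq : rot q = q by apply: side_eq; [rewrite Et|rewrite Ei].
have /iter_findex := rot_trans Eqr; elim: (findex _ _ _) => [<- //|m IHm] E.
by apply: IHm; rewrite iterSr fixq in E.
Qed.

Lemma class_along_arc d i (h : (i < nsides d)%N) : cq (mkside h) = cq (first_side d).
Proof.
elim: i h => [|i IHi] h; first by congr cq; apply: side_eq.
have h0 : (i < nsides d)%N by exact: ltnW.
by rewrite -(rot_inner_corner h0) cq_rot reverseK IHi.
Qed.

Definition dart_rot d : dart := tag (rot (first_side d)).

Lemma first_side_rot d : first_side (dart_rot d) = rot (first_side d).
Proof.
by apply/esym/side_eq_first; rewrite rot_src; apply: src_first_side.
Qed.

Lemma class_dart_rot d : cq (first_side (dart_rot (opposite d))) = cq (first_side d).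
Proof.
rewrite first_side_rot cq_rot.
have h : ((nsides d).-1 < nsides d)%N by rewrite prednK ?nsides_gt0.
rewrite -(class_along_arc h); congr cq; apply: side_eq; rewrite /= ?oppositeK //.
by rewrite nsides_opposite subn1.
Qed.

(** The class of a region is constant along each face, so there are at most as
    many classes as faces. *)
Lemma class_count :
  (#|[set cq q | q : side]| <= fcard (face_next dart_rot opposite) dart)%N.
Proof.
set ph := face_next _ _.
have ph_inj : injective ph.
  apply: face_next_inj oppositeK => d d' /(congr1 first_side).
  by rewrite !first_side_rot => /rot_inj /first_side_inj.
have inv d : cq (first_side (froot ph d)) = cq (first_side d).
  have /iter_findex <- := connect_root (frel ph) d.
  by elim: (findex _ _ _) => //= m <-; rewrite class_dart_rot.
rewrite /n_comp_mem -[X in (_ <= X)%N]cardsE.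
apply: leq_trans (leq_imset_card (fun d => cq (first_side d)) _).
apply/subset_leq_card/subsetP => _ /imsetP[[d i] _ ->].
apply/imsetP; exists (froot ph d).
  by rewrite !inE andbT; apply: (roots_root (fconnect_sym ph_inj)).
rewrite inv -(class_along_arc (ltn_ord i)); congr cq.
exact: side_eq.
Qed.

End Transport.

(** An arc with m sides has m-1 inner corners, so subdividing the edges does not
    change V - E; the count of classes bounds the number of faces. *)
Lemma dart_map : (0 < #|V|)%N -> exists sg : dart -> dart,
  [/\ injective sg, forall d, source (sg d) = source d,
      forall d d', source d = source d' -> fconnect sg d d' &
      (#|{: dart}| + 2 <= (#|V| + fcard (face_next sg opposite) dart).*2)%N].
Proof.
move=> V0; have [K [rot [cq [rot_inj rot_src rot_trans cq_rot count]]]] := side_map V0.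
exists (dart_rot rot); split.
- move=> d d' /(congr1 first_side); rewrite !first_side_rot //.
  by move=> /rot_inj /first_side_inj.
- move=> d; have := first_side_rot rot_src d => E.
  by apply: (drawing_inj hd); rewrite -!src_first_side E rot_src.
- move=> d d' E.
  have /rot_trans/iter_findex Em : src (first_side d) = src (first_side d').
    by rewrite !src_first_side E.
  have -> : d' = iter (findex rot (first_side d) (first_side d')) (dart_rot rot) d.
    apply: first_side_inj; rewrite -[LHS]Em.
    by elim: (findex _ _ _) => //= m ->; rewrite first_side_rot.
  exact: fconnect_iter.
have le := class_count rot_inj rot_src rot_trans cq_rot.
have cardD : #|{: dart}| = (\sum_(d | half d) 1).*2%N.
  by rewrite -sum1_card (@sum_half (fun=> 1%N)) .
have split1 : (\sum_(d | half d) nsides d =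
    \sum_(d | half d) (nsides d).-1 + \sum_(d | half d) 1)%N.
  rewrite -big_split; apply: eq_bigr => d _ /=.
  by rewrite addn1 prednK ?nsides_gt0.
move: count le; rewrite card_sides size_points (sum_half nsides_opposite) split1 cardD.
move: #|[set cq q | q : side]| (fcard _ _) #|V| => a b c.
move: (\sum_(d | half d) _)%N (\sum_(d | half d) _)%N => m1 m2; clear; lia.
Qed.

End Drawing.

(** * Unavoidable configurations and the theorem *)

(** A form of the hypothesis that passes to induced subgraphs at once: no
    triangle [a b x] on an edge of a 4-cycle [a b c d]. *)
Definition no_tri_on_4cycle (V : finType) (e : rel V) : Prop :=
  forall a b c d x, e a b -> e b c -> e c d -> e d a -> a != c -> b != d ->
  e a x -> e b x -> False.

Lemma adjacent_free_no_tri_on_4cycle (V : finType) (e : rel V) :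
  simple_graph e ->
  (forall c4 c3 : seq V, graph_cycle e c4 -> size c4 = 4 ->
     graph_cycle e c3 -> size c3 = 3 -> ~ adjacent_cycles c4 c3) ->
  no_tri_on_4cycle e.
Proof.
move=> [e_sym e_irr] h43 a b c d x ab bc cd da ac bd ax bx.
have neq v w : e v w -> v != w by apply: contraTneq => ->; rewrite e_irr.
have [nab nbc ncd nda] : [/\ a != b, b != c, c != d & d != a] by split; apply: neq.
have [nax nbx] : a != x /\ b != x by split; apply: neq.
apply: (h43 [:: a; b; c; d] [:: a; b; x]) => //.
- rewrite /graph_cycle /ucycleb /= ab bc cd da !inE !negb_or nab ac nbc bd ncd.
  by rewrite eq_sym nda.
- by rewrite /graph_cycle /ucycleb /= ab bx e_sym ax !inE !negb_or nab nax nbx.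
apply/set0Pn; exists [set a; b]; rewrite inE; apply/andP; split; apply/imsetP;
  exists a; rewrite ?mem_head //= eqxx //.
Qed.

Section Unavoidable.
Variables (R : realType) (V : finType) (e : rel V).
Hypotheses (he : simple_graph e) (hplanar : planar R e).
Hypothesis no43 : no_tri_on_4cycle e.
Hypothesis V_gt0 : 0 < #|V|.
Hypothesis degree4 : forall v, 4 <= #|nbrs e setT v|.

Let e_sym : symmetric e. Proof. by case: he. Qed.
Let e_irr : irreflexive e. Proof. by case: he. Qed.
Let edge_neq v w : e v w -> v != w.
Proof. by apply: contraTneq => ->; rewrite e_irr. Qed.

(** A chord cuts a 5-cycle into a triangle and a 4-cycle. *)
Lemma pentagon_chord v0 v1 v2 v3 v4 :
  e v0 v1 -> e v1 v2 -> e v2 v3 -> e v3 v4 -> e v4 v0 ->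
  v2 != v4 -> v3 != v0 -> ~~ e v0 v2.
Proof.
move=> e01 e12 e23 e34 e40 n24 n30; apply/negP => e02.
by apply: (no43 e02 e23 e34 e40 _ n24 e01); [rewrite eq_sym|rewrite e_sym].
Qed.

(** Every other edge between the six vertices would create a triangle and a
    4-cycle with a common edge. *)
Lemma pentagon_roof_house u v0 v1 v2 v3 v4 :
  e v0 v1 -> e v1 v2 -> e v2 v3 -> e v3 v4 -> e v4 v0 ->
  v0 != v2 -> v1 != v3 -> v2 != v4 -> v3 != v0 -> v4 != v1 ->
  e u v0 -> e u v1 -> {in [:: u; v0; v1; v2; v3; v4], forall v, #|nbrs e setT v| = 4} ->
  house e setT u v0 v1 v2 v3 v4.
Proof.
move=> e01 e12 e23 e34 e40 n02 n13 n24 n30 n41 u0 u1 deg.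
have c02 := pentagon_chord e01 e12 e23 e34 e40 n24 n30.
have c13 := pentagon_chord e12 e23 e34 e40 e01 n30 n41.
have c24 := pentagon_chord e23 e34 e40 e01 e12 n41 n02.
have c30 := pentagon_chord e34 e40 e01 e12 e23 n02 n13.
have c41 := pentagon_chord e40 e01 e12 e23 e34 n13 n24.
have nu2 : u != v2 by apply: contraNneq c02 => <-; rewrite e_sym.
have nu3 : u != v3 by apply: contraNneq c30 => <-.
have nu4 : u != v4 by apply: contraNneq c41 => <-.
have [nu0 nu1] := (edge_neq u0, edge_neq u1).
have [n01 n12 n23 n34 n40] : [/\ v0 != v1, v1 != v2, v2 != v3, v3 != v4 & v4 != v0].
  by split; apply: edge_neq.
split => //.
- rewrite /= !inE !negb_or nu0 nu1 nu2 nu3 nu4 n01 n02 n12 n13 n23 n24 n34.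
  by rewrite (eq_sym v0 v3) n30 (eq_sym v0 v4) n40 (eq_sym v1 v4) n41.
- by move=> v _; rewrite inE.
- by rewrite u0 u1.
- by rewrite e01 e12 e23 e34 e40.
- apply/and3P; split; apply/negP => euv.
  + apply: (no43 u0 e01 e12 _ nu1 n02 u1 e01).
    by rewrite e_sym.
  + by apply: (no43 u1 e12 e23 _ nu2 n13 u0); rewrite e_sym.
  + have [e10 e04 e4u] : [/\ e v1 v0, e v0 v4 & e v4 u] by split; rewrite e_sym.
    by apply: (no43 u1 e10 e04 e4u nu0 _ u0 e10); rewrite eq_sym.
- by rewrite c02 e_sym c30 c13 e_sym c41 c24.
- by move=> v vK; rewrite deg.
Qed.

Lemma no_isolated_of_degree v : exists w, e v w.
Proof.
have /card_gt0P[w] : 0 < #|nbrs e setT v| by exact: leq_trans (degree4 v).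
by rewrite !inE; exists w.
Qed.

Section Rotation.
Notation dart := (dart e).
Notation opp := (opposite he).
Variable sg : dart -> dart.
Hypotheses (sg_inj : injective sg) (sg_src : forall d, source (sg d) = source d).
Hypothesis sg_trans : forall d d', source d = source d' -> fconnect sg d d'.

Notation ph := (face_next sg opp).
Notation n := (order ph).
Notation k := (order sg).
Let oppK : involutive opp := oppositeK he.
Let ph_inj : injective ph := face_next_inj sg_inj oppK.

Lemma source_ph d : source (ph d) = target d.
Proof. exact: sg_src. Qed.

Lemma source_sg_connect d d' : fconnect sg d d' -> source d' = source d.
Proof.
by move/iter_findex <-; elim: (findex _ _ _) => //= m <-; rewrite sg_src.
Qed.

Lemma order_degree d : k d = #|nbrs e setT (source d)|.
Proof.
have tgt_inj : {in fconnect sg d &, injective (@target V e)}.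
  move=> d1 d2 /source_sg_connect s1 /source_sg_connect s2 Et.
  by apply: dart_eq; rewrite ?s1 ?s2.
rewrite /order -(card_in_imset tgt_inj); apply: eq_card => w; rewrite !inE.
apply/imsetP/idP => [[d' /source_sg_connect s ->]|ew].
  by rewrite -s; apply: dart_edge.
exists (Sub (source d, w) ew) => //.
by apply: sg_trans.
Qed.

Lemma order_ge4 d : 4 <= k d. Proof. by rewrite order_degree. Qed.

Lemma sg_no_fix d : sg d != d.
Proof.
apply/eqP => E; have cyc : fcycle sg [:: d] by rewrite /= E eqxx.
have := order_le_cycle cyc (mem_head _ _).
by rewrite leqNgt ltnW // ltnW // order_ge4.
Qed.

Lemma sg_no_fix2 d : sg (sg d) != d.
Proof.
apply/eqP => E; have cyc : fcycle sg [:: d; sg d] by rewrite /= E !eqxx.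
have := order_le_cycle cyc (mem_head _ _).
by rewrite leqNgt ltnW // order_ge4.
Qed.

(** A face that turns back at a vertex reveals a vertex of degree one. *)
Lemma no_turn_back d : target (ph d) != source d.
Proof.
apply/eqP => E; have := sg_no_fix (opp d); rewrite -[sg _]/(ph d) => /eqP[].
by apply: dart_eq; [rewrite source_ph|rewrite E].
Qed.

Lemma face_size_ge3 d : 3 <= n d.
Proof.
case E : (n d) => [|[|[|m]]] //.
- by have := order_gt0 ph d; rewrite E.
- have := iter_order ph_inj d; rewrite E /= => Ed.
  by have := source_neq_target he d; rewrite -{1}Ed source_ph eqxx.
have := iter_order ph_inj d; rewrite E /= => Ed.
by have := no_turn_back d; rewrite -source_ph Ed eqxx.
Qed.

(** Two triangles on the same edge [u w] have distinct apices, for otherwise [u]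
    would have degree two; together they form a 4-cycle with the chord [u w]. *)
Lemma tri_opposite_map d : tri sg opp d -> ~~ tri sg opp (opp d) /\ n (opp d) != 4.
Proof.
move=> /eqP/(iter_order3 ph_inj) E3.
set d1 := ph d in E3; set d2 := ph d1 in E3.
have s1 : source d1 = target d by exact: source_ph.
have s2 : source d2 = target d1 by exact: source_ph.
have t2 : target d2 = source d by rewrite -source_ph E3.
have e1 := dart_edge d1; have e2 := dart_edge d2; have e0 := dart_edge d.
rewrite s1 -s2 in e1; rewrite t2 in e2.
have so : source (opp d) = target d by [].
have to : target (opp d) = source d by [].
set f := opp d; set f1 := ph f; set f2 := ph f1.
have sf1 : source f1 = source d by rewrite source_ph.
have sf2 : source f2 = target f1 by exact: source_ph.
have ef1 := dart_edge f1; have ef2 := dart_edge f2; rewrite sf1 -sf2 in ef1.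
split.
  apply/negP => /eqP/(iter_order3 ph_inj) F3.
  have tf2 : target f2 = target d by rewrite -so -/f -F3 source_ph.
  rewrite tf2 in ef2.
  have [Exy|nxy] := eqVneq (source d2) (source f2).
    have Ef1 : f1 = opp d2.
      by apply: dart_eq; [rewrite sf1 -t2|rewrite -sf2 -Exy].
    have sgd : sg d = f1 by rewrite /f1 /face_next /f oppK.
    by have := sg_no_fix2 d; rewrite sgd Ef1 -[sg _]/(ph d2) E3 eqxx.
  apply: (@no43 (source d) (source d2) (target d) (source f2) (target d)) => //.
  - by rewrite e_sym.
  - by rewrite e_sym.
  - by rewrite e_sym.
  - by rewrite e_sym.
  - exact: edge_neq.
  by rewrite e_sym.
apply/eqP => /(iter_order4 ph_inj) F4.
set f3 := ph f2 in F4 *.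
have sf3 : source f3 = target f2 by exact: source_ph.
have tf3 : target f3 = target d by rewrite -so -/f -F4 source_ph.
have ef3 := dart_edge f3; rewrite tf3 in ef3; rewrite -sf3 in ef2.
apply: (@no43 (target d) (source d) (source f2) (source f3) (source d2)) => //.
- by rewrite e_sym.
- by rewrite eq_sym sf2 (no_turn_back f).
- by rewrite eq_sym sf3 -sf1 (no_turn_back f1).
by rewrite e_sym.
Qed.

Definition house_at d : bool :=
  [&& n d == 5, all (fun x => k x == 4) (orbit ph d), tri sg opp (opp d)
    & k (ph (ph (opp d))) == 4].

Lemma house_atP d : house_at d -> exists u a b c x y, house e setT u a b c x y.
Proof.
case/and4P => /eqP n5 /allP k4 /eqP/(iter_order3 ph_inj) E3 /eqP ku.
have E5 := iter_order5 ph_inj n5.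
have deg i : #|nbrs e setT (source (iter i ph d))| = 4.
  by rewrite -order_degree; apply/eqP/k4; rewrite -fconnect_orbit fconnect_iter.
pose v i := source (iter i ph d).
have ev i : e (v i) (v i.+1) by rewrite /v /= source_ph; apply: dart_edge.
have nv i : v i != v i.+2.
  by rewrite /v /= (source_ph (ph _)) eq_sym no_turn_back.
have [v5 v6] : v 5 = v 0 /\ v 6 = v 1 by rewrite /v /= E5.
set u := source (ph (ph (opp d))).
exists u, (v 0), (v 1), (v 2), (v 3), (v 4).
apply: pentagon_roof_house => //.
- by rewrite -v5.
- by rewrite -v5.
- by rewrite -v6.
- have := dart_edge (ph (opp d)); rewrite -source_ph -/u source_ph e_sym.
  by [].
- have := dart_edge (ph (ph (opp d))); rewrite -/u -source_ph E3.
  by rewrite /v /= source_ph.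
move=> w; rewrite !inE => /or3P[/eqP->|/eqP->|]; last case/or4P => /eqP->.
- by rewrite -order_degree.
- exact: (deg 0).
- exact: (deg 1%N).
- exact: (deg 2%N).
- exact: (deg 3%N).
exact: (deg 4%N).
Qed.

Lemma vertex_count : #|V| <= fcard sg dart.
Proof.
rewrite /n_comp_mem -[X in _ <= X]cardsE.
apply: leq_trans (leq_imset_card (@source V e) _).
rewrite -cardsT; apply/subset_leq_card/subsetP => v _.
have [w ew] := no_isolated_of_degree v; pose d : dart := Sub (v, w) ew.
apply/imsetP; exists (froot sg d).
  by rewrite !inE andbT; apply: (roots_root (fconnect_sym sg_inj)).
by rewrite (source_sg_connect (connect_root _ d)).
Qed.

End Rotation.

Lemma house_exists : exists u a b c d x, house e setT u a b c d x.
Proof.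
have [pos [arc hd]] := hplanar.
have [sg [sg_inj sg_src sg_trans euler]] := dart_map he hd no_isolated_of_degree V_gt0.
have [/existsP[d /house_atP]|/existsPn none] := boolP [exists d, house_at sg d].
  exact.
have := euler_defect sg_inj (oppositeK he) (face_size_ge3 sg_inj sg_src sg_trans)
  (order_ge4 sg_src sg_trans) (tri_opposite_map sg_inj sg_src sg_trans).
move=> /(_ _)/wrap[|le].
  move=> d n5 k4 td; have := none d; rewrite /house_at n5 td eqxx /=.
  suff -> : all (fun x => order sg x == 4) (orbit (face_next sg (opposite he)) d) by [].
  apply/allP => x; rewrite -fconnect_orbit => /iter_findex <-.
  by rewrite k4.
have := vertex_count sg_inj sg_src; move: le euler; clear; lia.
Qed.

End Unavoidable.

Section Subgraph.
Variables (R : realType) (V : finType) (e : rel V) (W : {set V}).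
Hypotheses (he : simple_graph e) (hplanar : planar R e) (no43 : no_tri_on_4cycle e).

Let T : finType := {v | v \in W}.
Let eT : rel T := relpre val e.

Lemma subgraph_planar : planar R eT.
Proof.
have [pos [arc [p_inj p_arc p_vertex p_cross]]] := hplanar.
exists (pos \o val), (fun u v => arc (val u) (val v)); split => /=.
- by move=> u v /p_inj/val_inj.
- by move=> u v; apply: p_arc.
- by move=> u v w p; apply: p_vertex.
move=> u v x y p euv exy ne; apply: p_cross => //; apply: contra ne => /eqP E.
have setE (a b : T) : val @: [set a; b] = [set val a; val b].
  by rewrite imsetU !imset_set1.
by apply/eqP/(imset_inj val_inj); rewrite !setE.
Qed.

Lemma nbrs_subgraph (v : T) : nbrs e W (val v) = val @: nbrs eT setT v.
Proof.
apply/setP => w; rewrite inE; apply/andP/imsetP => [[wW ew]|[x]].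
  by exists (Sub w wW) => //; rewrite !inE.
by rewrite !inE => ex ->; rewrite (valP x).
Qed.

Lemma unavoidable : W != set0 ->
  (exists2 v, v \in W & #|nbrs e W v| <= 3) \/
  (exists u a b c d x, house e W u a b c d x).
Proof.
case/set0Pn => w wW.
have [/existsP[v /andP[vW n3]]|/existsPn none] :=
    boolP [exists v, (v \in W) && (#|nbrs e W v| <= 3)]; first by left; exists v.
right; have card_nbrs (v : T) : #|nbrs e W (val v)| = #|nbrs eT setT v|.
  by rewrite nbrs_subgraph card_imset //; exact: val_inj.
have simpleT : simple_graph eT.
  by case: he => s i; split=> [u v|u]; [exact: s|exact: i].
have no43T : no_tri_on_4cycle eT by move=> a b c d x; apply: no43.
have [|v|u [a [b [c [d [x [uq _ roof cyc apex chord deg]]]]]]] :=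
    house_exists simpleT subgraph_planar no43T.
- by apply/card_gt0P; exists (Sub w wW).
- by have := none (val v); rewrite (valP v) -ltnNge card_nbrs.
exists (val u), (val a), (val b), (val c), (val d), (val x).
have mapE : [:: val u; val a; val b; val c; val d; val x]
    = map val [:: u; a; b; c; d; x] by [].
split=> //.
- by rewrite mapE => _ /mapP[y _ ->]; exact: valP.
by rewrite mapE => _ /mapP[y yK ->]; rewrite card_nbrs deg.
Qed.

End Subgraph.

Theorem theorem2p3 (R : realType) (V : finType) (e : rel V)
    (he : simple_graph e) (hplanar : planar R e)
    (h43 : forall c4 c3 : seq V,
       graph_cycle e c4 -> size c4 = 4 ->
       graph_cycle e c3 -> size c3 = 3 ->
       ~ adjacent_cycles c4 c3) :
  DP_vertex_arborable 2 e.
Proof.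
move=> C L H hL hH.
have no43 := adjacent_free_no_tri_on_4cycle he h43.
have [f gf] := good_coloring_exists he hL hH (fun W => unavoidable he hplanar no43).
exact: good_DP_forested_coloring gf.
Qed.
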